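(* Let $\mathcal S$ be a Garland poset. Then $G=(A_{\mathcal S},B_{\mathcal S},\mathfrak a)$ is a Garland structure with: (i) $\alpha_G=\inf_{a\in S^{-1}}\alpha_{A_a}$; and (ii) $\beta_H\le\frac{n_0-n_{010}}{n_0}$ for every Garland substructure $H=(A_H,B_H,\mathfrak a^H)$ of $G$ with $\ker(\mathfrak b_1)\cap B_H^0\neq 0$. In particular, $B_{\mathcal S}$ is acyclic (that is, $H^0(B_{\mathcal S})=0$) if $\frac{n_0-n_{010}}{n_0}<\alpha_{A_a}$ for every $a\in S^{-1}$.
   Context: Hilbert spaces are real, maps of Hilbert spaces are bounded linear, $\mathfrak b^*$ is the adjoint and $\mathfrak p_X$ the orthogonal projection onto a closed subspace $X$. Complexes and Garland structures. A $3$-term complex $(A,\mathfrak a)$ is a sequence $A^{-1}\xrightarrow{\mathfrak a_0}A^0\xrightarrow{\mathfrak a_1}A^1$ of maps of Hilbert spaces with $\mathfrak a_1\mathfrak a_0=0$; $H^0(A)=\ker(\mathfrak a_1)/\overline{\operatorname{im}(\mathfrak a_0)}\cong\ker(\mathfrak a_0^* )\cap\ker(\mathfrak a_1)$; $A$ is exact if $H^0(A)=0$. For a $3$-term complex put $\alpha_A=\inf\{\|\mathfrak a_1(\phi)\|^2:\phi\in\ker(\mathfrak a_0^* ),\|\phi\|=1\}$ (infimum over the empty set is $+\infty$). A Garland structure $G=(A,B,\mathfrak a)$ is a pair of $3$-term complexes $(A,\mathfrak a),(B,\mathfrak b)$ with $A$ exact, $B^i\subseteq A^i$ closed subspaces,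 $B^{-1}=A^{-1}$, and $\mathfrak b_i=\mathfrak p_{B^i}\mathfrak a_i$ (restricted to $B^{i-1}$). Put $\alpha_G=\alpha_A$ and $\beta_G=\sup\{\|\mathfrak a_1(\phi)\|^2:\phi\in\ker(\mathfrak b_1),\|\phi\|=1\}$ (supremum over the empty set is $-\infty$). A Garland structure $H=(A_H,B_H,\mathfrak a^H)$ is a substructure of $G=(A,B,\mathfrak a)$ if $A_H$ is a subcomplex of $A$, $B_H$ is a subcomplex of $B$ (so the maps of $B_H$ are the restrictions of those of $B$), and $\mathfrak a^H$ is the restriction of $\mathfrak a$. Garland posets. For a poset $S$, $\operatorname{Cov}(S)$ is the set of pairs $(x,y)$ with $y$ covering $x$; $S_{>x}$, $S_{<x}$, $S_{\ge x}$, $S_{\le x}$ are the subposets of elements greater than, less than, etc., $x$. A Garland poset $\mathcal S=(S,\le,w,n,\rho)$ is a poset $(S,\le)$ with a cover-preserving poset map $\rho:S\to\{-1<0<1\}$, an orientation $w:\operatorname{Cov}(S)\to\{-1,+1\}$, $(x,y)\mapsto w_{xy}$, and numbers $n_0,n_1,n_{010}$ such that, writing $S^i=\rho^{-1}(i)$ and $S^i_{<c}=S^i\cap S_{<c}$ etc.: (P1) $|S_{<b}|=n_0$ for $b\in S^0$; (P2) $|S^{-1}_{<c}|=n_1$ for $c\in S^1$; (P3) if $b\ne b'$ in $S^0$ and $c\in S^1$ with $b<c>b'$, then $|S_{<b}\cap S_{<b'}|=n_{010}$; (P4) for $a\in S^{-1}$ the poset $S_{>a}$ is finite and connected; (P5)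 if $a\in S^{-1}$, $c\in S^1$, $a<c$, then $S_{>a}\cap S_{<c}=\{b,b'\}$ with $w_{ab}w_{bc}=-w_{ab'}w_{b'c}$ (so $b\ne b'$). Associated complexes. For $i\in\{-1,0,1\}$ consider the Hilbert space with orthonormal basis $\{z_{axc}: a\in S^{-1},x\in S^i,c\in S^1,a\le x\le c\}$. For $a\in S^{-1}$, $x\in S^i$, $a\le x$ put $z_{ax}=\sum_{c\in S^1_{\ge x}}z_{axc}$, and for $x\in S^i$ put $z_x=\sum_{a\in S^{-1}_{\le x}}z_{ax}$. Let $A^i$ be the closed subspace generated by all $z_{ax}$ ($a\in S^{-1}$, $x\in S^i$, $a\le x$) and $B^i\subseteq A^i$ the closed subspace generated by all $z_x$ ($x\in S^i$). The formula $\mathfrak a_i(z_{ax})=\sum_{y\in S^i_{>x}}w_{xy}z_{ay}$ (for $x\in S^{i-1}$, $i=0,1$) defines the $3$-term complex $A_{\mathcal S}:A^{-1}\xrightarrow{\mathfrak a_0}A^0\xrightarrow{\mathfrak a_1}A^1$, and $B_{\mathcal S}:B^{-1}\xrightarrow{\mathfrak b_0}B^0\xrightarrow{\mathfrak b_1}B^1$ has maps $\mathfrak b_i=\mathfrak p_{B^i}\mathfrak a_i$. For $a\in S^{-1}$, $A_a$ is the subcomplex of $A_{\mathcal S}$ with $A_a^i$ generated by $\{z_{ax}:x\in S^i_{\ge a}\}$. *)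

(* Defs.v *)
From HB Require Import structures.
From mathcomp Require Import all_boot all_order all_algebra.
From mathcomp Require Import all_classical all_reals all_analysis.

Set Implicit Arguments.
Unset Strict Implicit.
Unset Printing Implicit Defensive.

Import Order.TTheory GRing.Theory Num.Theory.
Import numFieldNormedType.Exports.

Local Open Scope classical_set_scope.
Local Open Scope card_scope.
Local Open Scope ring_scope.

HB.mixin Record CompleteNormedModule_isHilbert (R : realType) V
    & CompleteNormedModule R V := {
  inner : {dot V for @idfun R} ;
  innerxx : forall x : V, inner x x = `|x| ^+ 2 }.

#[short(type="hilbertType")]
HB.structure Definition Hilbert (R : realType) :=
  {V of CompleteNormedModule_isHilbert R V & CompleteNormedModule R V}.

Section HilbertSpaces.
Context {R : realType}.

Definition closed_subspace {E : hilbertType R} (X : set E) :=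
  [/\ closed X, X 0 & forall (k : R) x y, X x -> X y -> X (k *: x + y)].

Definition closed_span {E : hilbertType R} (A : set E) : set E :=
  smallest closed_subspace A.

Definition orthonormal_basis {T : eqType} {E : hilbertType R}
    (D : set T) (e : T -> E) :=
  (forall s t, D s -> D t -> inner (e s) (e t) = (s == t)%:R) /\
  closed_span (e @` D) = setT.

(* A map between closed subspaces X and Y is represented by a function on the
   ambient spaces; its values outside X are irrelevant. *)
Definition bounded_linear_on {E F : hilbertType R} (X : set E) (Y : set F)
    (f : E -> F) :=
  [/\ forall x, X x -> Y (f x),
      forall (k : R) x y, X x -> X y -> f (k *: x + y) = k *: f x + f y
    & exists M : R, forall x, X x -> `|f x| <= M * `|x|].

Definition orth_proj {E : hilbertType R} (X : set E) (y : E) : E :=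
  xget 0 [set x | X x /\ forall u, X u -> inner u (y - x) = 0].

(* The adjoint of f : X -> Y at y in Y, that is, the Riesz representative in X
   of u |-> <f u, y>; it exists if X is a closed subspace and f is bounded and
   linear on X. *)
Definition adjoint_on {E F : hilbertType R} (X : set E) (f : E -> F) (y : F)
    : E :=
  xget 0 [set x | X x /\ forall u, X u -> inner u x = inner (f u) y].

End HilbertSpaces.

(* The three spaces of a complex are closed subspaces of ambient Hilbert spaces,
   so that complexes and their subcomplexes live in the same ambient spaces. *)
Record complex3 (R : realType) (Em E0 E1 : hilbertType R) := Complex3 {
  spm : set Em ;
  sp0 : set E0 ;
  sp1 : set E1 ;
  map0 : Em -> E0 ;
  map1 : E0 -> E1 }.

Section Garland.
Context {R : realType} {Em E0 E1 : hilbertType R}.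
Implicit Types C A B : complex3 Em E0 E1.

Definition is_complex3 C :=
  [/\ [/\ closed_subspace (spm C), closed_subspace (sp0 C)
        & closed_subspace (sp1 C)],
      bounded_linear_on (spm C) (sp0 C) (map0 C),
      bounded_linear_on (sp0 C) (sp1 C) (map1 C)
    & forall x, spm C x -> map1 C (map0 C x) = 0].

Definition ker1 C : set E0 := [set x | sp0 C x /\ map1 C x = 0].

Definition ker0adj C : set E0 :=
  [set x | sp0 C x /\ adjoint_on (spm C) (map0 C) x = 0].

(* H^0 = ker(map1) / closure(im(map0)) is zero. *)
Definition H0_eq0 C := ker1 C = closure (map0 C @` spm C).

Definition alpha C : \bar R :=
  ereal_inf [set (`|map1 C x| ^+ 2)%:E | x in ker0adj C `&` [set x | `|x| = 1]].

Definition garland_structure A B :=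
  [/\ is_complex3 A /\ is_complex3 B,
      H0_eq0 A,
      [/\ spm B = spm A, sp0 B `<=` sp0 A & sp1 B `<=` sp1 A],
      forall x, spm B x -> map0 B x = orth_proj (sp0 B) (map0 A x)
    & forall x, sp0 B x -> map1 B x = orth_proj (sp1 B) (map1 A x)].

Definition beta A B : \bar R :=
  ereal_sup [set (`|map1 A x| ^+ 2)%:E | x in ker1 B `&` [set x | `|x| = 1]].

Definition subcomplex C' C :=
  [/\ is_complex3 C',
      [/\ spm C' `<=` spm C, sp0 C' `<=` sp0 C & sp1 C' `<=` sp1 C],
      forall x, spm C' x -> map0 C' x = map0 C x
    & forall x, sp0 C' x -> map1 C' x = map1 C x].

Definition garland_substructure AH BH A B :=
  [/\ garland_structure AH BH, subcomplex AH A & subcomplex BH B].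

End Garland.

Section Posets.
Context {d : Order.disp_t} {S : porderType d}.

Definition covers (x y : S) :=
  (x < y)%O /\ forall z, ~ ((x < z)%O /\ (z < y)%O).

(* Any two elements of X are joined by a path of comparabilities in X. *)
Definition poset_connected (X : set S) :=
  forall x y, X x -> X y ->
    exists p : seq S, [/\ path (fun u v => u >=< v)%O x p, last x p = y
                        & {in p, forall u, X u}].

End Posets.

Record garlandPoset (d : Order.disp_t) (S : porderType d) := GarlandPoset {
  rho : S -> int ;
  wgt : S -> S -> int ; (* only its values on covering pairs matter *)
  n0 : nat ;
  n1 : nat ;
  n010 : nat ;
  rho_range : forall x, -1 <= rho x <= 1 ;
  rho_homo : forall x y, (x <= y)%O -> rho x <= rho y ;
  rho_covers : forall x y, covers x y -> covers (rho x) (rho y) ;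
  wgt_sign : forall x y, covers x y -> wgt x y = -1 \/ wgt x y = 1 ;
  garlandP1 : forall b, rho b = 0 -> [set x | (x < b)%O] #= `I_n0 ;
  garlandP2 : forall c, rho c = 1 ->
    [set a | rho a = -1 /\ (a < c)%O] #= `I_n1 ;
  garlandP3 : forall b b' c, rho b = 0 -> rho b' = 0 -> rho c = 1 ->
    b <> b' -> (b < c)%O -> (b' < c)%O ->
    [set x | (x < b)%O /\ (x < b')%O] #= `I_n010 ;
  garlandP4 : forall a, rho a = -1 ->
    finite_set [set x | (a < x)%O] /\ poset_connected [set x | (a < x)%O] ;
  garlandP5 : forall a c, rho a = -1 -> rho c = 1 -> (a < c)%O ->
    exists b b', [set x | (a < x)%O /\ (x < c)%O] = [set b; b'] /\
      wgt a b * wgt b c = - (wgt a b' * wgt b' c) }.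

Section AssociatedComplexes.
Context {R : realType} {d : Order.disp_t} {S : porderType d}.
Variable P : garlandPoset S.

Definition level (i : int) : set S := [set x | rho P x = i].

Definition triples (i : int) : set (S * S * S) :=
  [set t | let: (a, x, c) := t in
    [/\ level (-1) a, level i x, level 1 c, (a <= x)%O & (x <= c)%O]].

Section Level.
Context {E : hilbertType R}.
Variables (i : int) (z : S * S * S -> E).

Definition zpair (a x : S) : E :=
  \sum_(c \in [set c | level 1 c /\ (x <= c)%O]) z (a, x, c).

Definition zpoint (x : S) : E :=
  \sum_(a \in [set a | level (-1) a /\ (a <= x)%O]) zpair a x.

Definition flags : set (S * S) :=
  [set t | [/\ level (-1) t.1, level i t.2 & (t.1 <= t.2)%O]].

Definition spA : set E := closed_span [set zpair t.1 t.2 | t in flags].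

Definition spB : set E := closed_span (zpoint @` level i).

Definition spAat (a : S) : set E :=
  closed_span (zpair a @` [set x | level i x /\ (a <= x)%O]).

End Level.

Definition cobd_formula {E F : hilbertType R} (i : int)
    (z : S * S * S -> E) (z' : S * S * S -> F) (f : E -> F) :=
  forall a x, level (-1) a -> level (i - 1) x -> (a <= x)%O ->
    f (zpair z a x) =
    \sum_(y \in [set y | level i y /\ (x < y)%O]) (wgt P x y)%:~R *: zpair z' a y.

(* The bounded linear map spA (i - 1) -> spA i given by the formula, which
   determines it on spA (i - 1). *)
Definition cobd {E F : hilbertType R} (i : int)
    (z : S * S * S -> E) (z' : S * S * S -> F) : E -> F :=
  xget (fun=> 0) [set f | bounded_linear_on (spA (i - 1) z) (spA i z') f /\
                          cobd_formula i z z' f].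

Context {Em E0 E1 : hilbertType R}.
Variables (zm : S * S * S -> Em) (z0 : S * S * S -> E0) (z1 : S * S * S -> E1).

Definition complexA : complex3 Em E0 E1 :=
  Complex3 (spA (-1) zm) (spA 0 z0) (spA 1 z1) (cobd 0 zm z0) (cobd 1 z0 z1).

Definition complexB : complex3 Em E0 E1 :=
  Complex3 (spB (-1) zm) (spB 0 z0) (spB 1 z1)
    (orth_proj (spB 0 z0) \o map0 complexA)
    (orth_proj (spB 1 z1) \o map1 complexA).

Definition complexAat (a : S) : complex3 Em E0 E1 :=
  Complex3 (spAat (-1) zm a) (spAat 0 z0 a) (spAat 1 z1 a)
    (map0 complexA) (map1 complexA).

End AssociatedComplexes.

(* Main.v *)
Require Import Defs.
From HB Require Import structures.
From mathcomp Require Import all_boot all_order all_algebra.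
From mathcomp Require Import all_classical all_reals all_analysis.
From mathcomp Require Import ring lra zify finmap.

Set Implicit Arguments.
Unset Strict Implicit.
Unset Printing Implicit Defensive.

Import Order.TTheory GRing.Theory Num.Theory.
Import numFieldNormedType.Exports.

Local Open Scope classical_set_scope.
Local Open Scope card_scope.
Local Open Scope ring_scope.

(** The coboundaries of A are restrictions of operators on the whole Hilbert spaces,
T0 z_aac = sum_(a < b < c) w_ab z_abc and T1 z_abc = w_bc z_acc. By (P5) there are
two elements b between a and c, so T0 and the adjoint of T1 map orthonormal bases to
orthogonal families of square norm 2; therefore they exist and are bounded, however
large the sets S_(>a) are ([exists_T0], [exists_U], [adjoint_exists]), and T1 T0 = 0 is
the sign rule of (P5). Identities between continuous bilinear expressions are then
verified on the generators z_ax and z_x only.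

A is exact since a harmonic vector of A^0 has coordinates x_ab for which w_ab x_ab is
constant on the connected set S_(>a), and orthogonality to T0 z_aa makes the constant
zero ([harmonicA_eq0]). B is a complex because the projection of T0 z_aa to B^0 is
(1 / n0) sum_(b > a) w_ab z_b ([proj_T1_proj_T0]).

(i) A^0 is the closed orthogonal sum of the A_a^0, and T1 maps them to orthogonal
subspaces. So the form q(x) = |T1 x|^2 - r |x|^2 is nonnegative at a vector as soon as
it is nonnegative at its components ([block_quad_ge0]), and the components of an
element of ker a_0^* are in ker a_0^*.

(ii) With kappa = (n0 - n010) / n0, the axioms (P1) and (P3) give
<T1 x, T1 z_b> = kappa <x, z_b> + (n010 / n0) sum_(c > b) w_bc <T1 x, z_c>
for x in B^0, by counting the common lower bounds of two elements of level 0. If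
b_1 x = 0 the sum vanishes, so |T1 x|^2 = kappa |x|^2 ([ker1B_norm]). Substructures of
G have smaller kernels and restricted maps, which yields the bound on beta.

Finally, a harmonic vector x of B lies in ker a_0^* and has q(x) = 0 for r = kappa.
If kappa < alpha(A_a) for every a, then q is positive at the nonzero components
of x, so x = 0 ([H0_eq0_B]). The inequalities are used one component at a time,
because the infimum of the alpha(A_a) may equal kappa. *)

(** * Inner products *)

Section InnerProduct.
Context {R : realType} {E : hilbertType R}.
Implicit Types (x y z : E) (k : R).

Lemma innerC x y : inner x y = inner y x.
Proof. by have := hermC inner x y; rewrite expr0 mul1r. Qed.

Lemma innerDl x y z : inner (x + y) z = inner x z + inner y z.
Proof. by rewrite linearDl. Qed.

Lemma innerZl k x y : inner (k *: x) y = k * inner x y.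
Proof. by rewrite linearZl_LR. Qed.

Lemma innerDr x y z : inner z (x + y) = inner z x + inner z y.
Proof. by rewrite innerC innerDl !(innerC z). Qed.

Lemma innerZr k x y : inner y (k *: x) = k * inner y x.
Proof. by rewrite innerC innerZl !(innerC y). Qed.

Lemma inner0l x : inner 0 x = 0.
Proof. by rewrite -(scale0r (0 : E)) innerZl mul0r. Qed.

Lemma inner0r x : inner x 0 = 0.
Proof. by rewrite innerC inner0l. Qed.

Lemma innerNl x y : inner (- x) y = - inner x y.
Proof. by rewrite -scaleN1r innerZl mulN1r. Qed.

Lemma innerNr x y : inner y (- x) = - inner y x.
Proof. by rewrite innerC innerNl innerC. Qed.

Lemma innerBl x y z : inner (x - y) z = inner x z - inner y z.
Proof. by rewrite innerDl innerNl. Qed.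

Lemma innerBr x y z : inner z (x - y) = inner z x - inner z y.
Proof. by rewrite innerDr innerNr. Qed.

Lemma inner_suml I (r : seq I) (p : pred I) (f : I -> E) y :
  inner (\sum_(i <- r | p i) f i) y = \sum_(i <- r | p i) inner (f i) y.
Proof.
apply: (big_morph (fun x => inner x y)); last exact: inner0l.
by move=> u v; rewrite innerDl.
Qed.

Lemma inner_sumr I (r : seq I) (p : pred I) (f : I -> E) y :
  inner y (\sum_(i <- r | p i) f i) = \sum_(i <- r | p i) inner y (f i).
Proof. by rewrite innerC inner_suml; apply: eq_bigr => i _; rewrite innerC. Qed.

Lemma inner_eq0 x : inner x x = 0 -> x = 0.
Proof. by rewrite innerxx => /eqP; rewrite sqrf_eq0 normr_eq0 => /eqP. Qed.

Lemma sqr_normD x y : `|x + y| ^+ 2 = `|x| ^+ 2 + inner x y *+ 2 + `|y| ^+ 2.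
Proof.
rewrite -!innerxx innerDl !innerDr (innerC y x); ring.
Qed.

Lemma sqr_normB x y : `|x - y| ^+ 2 = `|x| ^+ 2 - inner x y *+ 2 + `|y| ^+ 2.
Proof. by rewrite sqr_normD innerNr normrN mulNrn. Qed.

(** The norm is given independently of the inner product, so its triangle
inequality already contains the Cauchy-Schwarz inequality. *)
Lemma inner_le x y : inner x y <= `|x| * `|y|.
Proof.
have : `|x + y| ^+ 2 <= (`|x| + `|y|) ^+ 2.
  by rewrite ler_sqr ?nnegrE ?addr_ge0// ler_normD.
by rewrite sqr_normD sqrrD lerD2r lerD2l lerMn2r.
Qed.

Lemma cauchy_schwarz x y : `|inner x y| <= `|x| * `|y|.
Proof.
rewrite ler_norml inner_le andbT lerNl -innerNl.
by rewrite (le_trans (inner_le _ _))// normrN.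
Qed.

Lemma closure_approx (X : set E) x :
  closure X x <-> forall e, 0 < e -> exists2 y, X y & `|x - y| < e.
Proof.
split=> [clX e e0|h].
  have [y [Xy xy]] := clX _ (nbhsx_ballx x e e0).
  by exists y => //; move: xy; rewrite -ball_normE.
move=> B /nbhs_ballP[e e0 eB]; have [y Xy xy] := h e e0.
by exists y; split => //; apply: eB; rewrite -ball_normE.
Qed.

Lemma closed_approx (X : set E) :
  closed X <->
  forall x, (forall e, 0 < e -> exists2 y, X y & `|x - y| < e) -> X x.
Proof.
split=> [cX x h|h x /closure_approx]; last exact: h.
by apply: cX; apply/closure_approx.
Qed.

Lemma cauchy_seq_limit (u : nat -> E) :
  (forall e, 0 < e -> exists N, forall m n, (N <= m)%N -> (N <= n)%N ->
     `|u m - u n| < e) ->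
  exists l, forall e, 0 < e -> exists N, forall n, (N <= n)%N -> `|l - u n| < e.
Proof.
move=> cu.
have /cauchy_cvgP/cvg_ex[l ul] : cauchy (u @ \oo).
  apply: cauchy_exP => e e0; have [N uN] := cu e e0.
  exists (u N); exists N => // n /= Nn.
  by rewrite -ball_normE; apply: uN.
exists l => e e0.
move/cvgrPdist_lt : ul => /(_ e e0)[N _ uN].
by exists N => n; apply: uN.
Qed.

End InnerProduct.

Lemma invS_small (R : realType) (e : R) : 0 < e ->
  exists N, forall n, (N <= n)%N -> n.+1%:R^-1 < e.
Proof.
move=> e0; have [N hN] := ltr_add_invr e0; exists N => n Nn.
by apply: le_lt_trans hN; rewrite add0r lef_pV2 ?posrE// ler_nat.
Qed.

(** * Closed subspaces and bounded maps *)

Section ClosedSubspaces.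
Context {R : realType} {E : hilbertType R}.
Implicit Types (x y z u : E) (k : R) (X Y : set E).

Lemma csubD X x y : closed_subspace X -> X x -> X y -> X (x + y).
Proof. by move=> [_ _ h] Xx Xy; rewrite -(scale1r x); apply: h. Qed.

Lemma csubZ X k x : closed_subspace X -> X x -> X (k *: x).
Proof. by move=> [_ h0 h] Xx; rewrite -(addr0 (_ *: _)); apply: h. Qed.

Lemma csubB X x y : closed_subspace X -> X x -> X y -> X (x - y).
Proof.
by move=> cX Xx Xy; apply: csubD => //; rewrite -scaleN1r; apply: csubZ.
Qed.

Lemma csub_sum X I (r : seq I) (p : pred I) (f : I -> E) : closed_subspace X ->
  (forall i, p i -> X (f i)) -> X (\sum_(i <- r | p i) f i).
Proof.
move=> cX h; apply: (big_ind X) => //; first by case: cX.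
by move=> x y; apply: csubD.
Qed.

Lemma closed_spanP (A : set E) : closed_subspace (closed_span A).
Proof.
split.
- by apply: closed_bigI => X [[]].
- by move=> X [[]].
- by move=> k x y hx hy X XA; case: (XA) => -[_ _ +] _; apply; [exact: hx|exact: hy].
Qed.

Lemma sub_closed_span (A : set E) : A `<=` closed_span A.
Proof. exact: sub_smallest. Qed.

(** Induction principle for closed spans: the property to prove has to define a
closed subspace. *)
Lemma closed_span_sub (A X : set E) :
  closed_subspace X -> A `<=` X -> closed_span A `<=` X.
Proof. exact: smallest_sub. Qed.

Lemma closure_csub X : X 0 ->
  (forall k x y, X x -> X y -> X (k *: x + y)) -> closed_subspace (closure X).
Proof.
move=> X0 XD; split; first exact: closed_closure.
  exact: subset_closure.
move=> k x y /closure_approx hx /closure_approx hy.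
apply/closure_approx => e e0.
have e1 : 0 < e / 2 / (`|k| + 1) by rewrite !divr_gt0// ltr_wpDl.
have [x' Xx' xx'] := hx _ e1.
have [y' Xy' yy'] := hy _ (divr_gt0 e0 (ltr0Sn _ 1)).
exists (k *: x' + y'); first exact: XD.
rewrite (_ : _ - _ = k *: (x - x') + (y - y')); last first.
  by rewrite scalerBr opprD addrACA.
rewrite (le_lt_trans (ler_normD _ _))// (splitr e) ler_ltD//.
rewrite normrZ; move: xx'; rewrite ltr_pdivlMr ?ltr_wpDl//.
by move=> /ltW; apply: le_trans; rewrite mulrC ler_wpM2l// lerDl.
Qed.

Lemma csub_setT : closed_subspace [set: E].
Proof. by split=> //; exact: closedT. Qed.

(** The bound is assumed on [X] only, because the maps of a complex are
unconstrained off their domains. *)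
Lemma csub_kernel (F : normedModType R) X (f : E -> F) : closed_subspace X ->
  (forall k x y, X x -> X y -> f (k *: x + y) = k *: f x + f y) ->
  (exists M, forall x, X x -> `|f x| <= M * `|x|) ->
  closed_subspace [set x | X x /\ f x = 0].
Proof.
move=> cX lf [M hM]; case: (cX) => /closed_approx clX X0 XD.
have f0 : f 0 = 0.
  by have /esym/eqP := lf 1 0 0 X0 X0; rewrite !scale1r addr0 -subr_eq0 addrK => /eqP.
split=> [|//|k x y [Xx fx] [Xy fy]]; last first.
  by split; [exact: XD|rewrite lf// fx fy scaler0 addr0].
apply/closed_approx => x h.
have Xx : X x by apply: clX => e e0; have [y [Xy _] xy] := h e e0; exists y.
split=> //; apply/eqP; rewrite -normr_le0; apply/ler_addgt0Pr => e e0.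
have M0 : 0 < `|M| + 1 by rewrite ltr_wpDl.
have [y /= [Xy fy]] := h _ (divr_gt0 e0 M0).
rewrite ltr_pdivlMr// add0r => /ltW; apply: le_trans.
have -> : f x = f (x - y) by rewrite addrC -scaleN1r lf// fy scaler0 add0r.
rewrite (le_trans (hM _ (csubB cX Xx Xy)))// mulrC ler_wpM2l//.
by rewrite (le_trans (ler_norm M))// lerDl.
Qed.

End ClosedSubspaces.

Definition bounded_map {R : realType} {E F : hilbertType R} (f : E -> F) :=
  (forall (k : R) x y, f (k *: x + y) = k *: f x + f y) /\
  exists2 M : R, 0 <= M & forall x, `|f x| <= M * `|x|.

Section BoundedMaps.
Context {R : realType} {E F : hilbertType R}.
Implicit Types (f g : E -> F).

Lemma bmapD f x y : bounded_map f -> f (x + y) = f x + f y.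
Proof. by move=> [h _]; rewrite -{1}(scale1r x) h scale1r. Qed.

Lemma bmap0 f : bounded_map f -> f 0 = 0.
Proof. by move=> bf; apply: (addrI (f 0)); rewrite -bmapD// !addr0. Qed.

Lemma bmapZ f k x : bounded_map f -> f (k *: x) = k *: f x.
Proof. by move=> bf; rewrite -[X in f X]addr0 bf.1 bmap0// addr0. Qed.

Lemma bmapB f x y : bounded_map f -> f (x - y) = f x - f y.
Proof. by move=> bf; rewrite bmapD// -scaleN1r bmapZ// scaleN1r. Qed.

Lemma bmap_sum f I (r : seq I) (p : pred I) (g : I -> E) : bounded_map f ->
  f (\sum_(i <- r | p i) g i) = \sum_(i <- r | p i) f (g i).
Proof.
move=> bf; apply: (big_morph f); last exact: bmap0.
by move=> x y; apply: bmapD.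
Qed.

Lemma csub_preimage f (Y : set F) : bounded_map f -> closed_subspace Y ->
  closed_subspace (f @^-1` Y).
Proof.
move=> bf cY; split.
- apply/closed_approx => x h /=.
  case: (cY) => /closed_approx cY' _ _; apply: cY' => e e0.
  case: bf.2 => M M0 hM.
  have e1 : 0 < e / (M + 1) by rewrite divr_gt0// ltr_wpDl.
  have [y Yy xy] := h _ e1.
  exists (f y) => //; rewrite -bmapB// (le_lt_trans (hM _))//.
  move: xy; rewrite ltr_pdivlMr ?ltr_wpDl//; apply: le_lt_trans.
  by rewrite mulrC ler_wpM2l// lerDl.
- by rewrite /= bmap0//; case: cY.
- by move=> k x y /= hx hy; rewrite bf.1; case: cY => _ _; apply.
Qed.

Lemma bounded_sub f g : bounded_map f -> bounded_map g ->
  bounded_map (fun x => f x - g x).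
Proof.
move=> bf bg; split=> [k x y|]; first by rewrite bf.1 bg.1 scalerBr opprD addrACA.
case: bf.2 bg.2 => [M M0 hM] [N N0 hN]; exists (M + N); first exact: addr_ge0.
by move=> x; rewrite mulrDl (le_trans (ler_normB _ _))// lerD.
Qed.

Lemma csub_vanish f : bounded_map f -> closed_subspace [set x | f x = 0].
Proof.
move=> [lf [M _ hM]].
have -> : [set x | f x = 0] = [set x | setT x /\ f x = 0].
  by apply/seteqP; split => x //= [].
by apply: (csub_kernel csub_setT) => //; exists M.
Qed.

End BoundedMaps.

Lemma bounded_id (R : realType) (E : hilbertType R) : bounded_map (@id E).
Proof. by split => //; exists 1 => // x; rewrite mul1r. Qed.

Lemma bounded_comp (R : realType) (E F G : hilbertType R) (g : F -> G) (f : E -> F) :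
  bounded_map g -> bounded_map f -> bounded_map (g \o f).
Proof.
move=> [lg [N N0 hN]] [lf [M M0 hM]]; split=> [k x y|]; first by rewrite /= lf lg.
exists (N * M); first exact: mulr_ge0.
by move=> x; rewrite -mulrA (le_trans (hN _))// ler_wpM2l.
Qed.

Section Functionals.
Context {R : realType} {E : hilbertType R}.

Lemma csub_functional (f : E -> R) :
  (forall k x y, f (k *: x + y) = k * f x + f y) ->
  (exists M, forall x, `|f x| <= M * `|x|) ->
  closed_subspace [set x | f x = 0].
Proof.
move=> lf [M hM].
have -> : [set x | f x = 0] = [set x | setT x /\ f x = 0].
  by apply/seteqP; split => x //= [].
by apply: (@csub_kernel _ _ R^o _ _ csub_setT) => //; exists M.
Qed.

Lemma csub_inner_eq (F : hilbertType R) (f : E -> F) (u : E) (v : F) c :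
  bounded_map f -> closed_subspace [set x | inner (f x) v = c * inner x u].
Proof.
move=> bf; rewrite (_ : [set x | _] =
    [set x | inner (f x) v - c * inner x u = 0]); last first.
  apply/seteqP; split => x /= => [->|/eqP]; first by rewrite subrr.
  by rewrite subr_eq0 => /eqP.
apply: csub_functional => [k x y|].
  rewrite bf.1 !innerDl !innerZl; ring.
case: bf.2 => M M0 hM; exists (M * `|v| + `|c| * `|u|) => x.
rewrite (le_trans (ler_normB _ _))// mulrDl lerD//.
  by rewrite (le_trans (cauchy_schwarz _ _))// mulrAC ler_wpM2r.
by rewrite normrM -mulrA ler_wpM2l// mulrC cauchy_schwarz.
Qed.

(** Orthogonality to the image of a spanning set passes to its closed span; most
identities between vectors below are checked on generators this way. *)
Lemma bmap_orth_span (F : hilbertType R) (f : E -> F) (A : set E) (v : F) :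
  bounded_map f -> (forall x, A x -> inner (f x) v = 0) ->
  forall x, closed_span A x -> inner (f x) v = 0.
Proof.
move=> bf h x Ax; have cX := csub_inner_eq 0 v 0 bf.
have := closed_span_sub cX _ Ax; rewrite /= mul0r; apply=> u Au /=.
by rewrite mul0r h.
Qed.

Lemma orth_closed_span (A : set E) (v : E) :
  (forall x, A x -> inner x v = 0) ->
  forall x, closed_span A x -> inner x v = 0.
Proof. exact: (bmap_orth_span (bounded_id E)). Qed.

Lemma span_orth2 (F : hilbertType R) (f : E -> F) (A B : set E) :
  bounded_map f -> (forall x y, A x -> B y -> inner (f x) (f y) = 0) ->
  forall x y, closed_span A x -> closed_span B y -> inner (f x) (f y) = 0.
Proof.
move=> bf h x y Ax By; apply: (bmap_orth_span bf _ Ax) => u Au.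
rewrite innerC; apply: (bmap_orth_span bf _ By) => v Bv.
by rewrite innerC; exact: h.
Qed.

End Functionals.

(** * Orthogonal projections and Riesz representation *)

Section Projection.
Context {R : realType} {E : hilbertType R}.
Implicit Types (x y z u : E) (X : set E).

(** A minimizing sequence is Cauchy by the parallelogram law, since the midpoint
of two of its terms is again at least as far from [y] as the infimum. *)
Lemma nearest_point X y : closed_subspace X ->
  exists2 l, X l & forall u, X u -> `|y - l| <= `|y - u|.
Proof.
move=> cX; set D := [set `|y - u| | u in X].
have X0 : X 0 by case: cX.
have hD : has_inf D.
  split; first by exists `|y - 0|, 0.
  by exists 0 => _ [u _ <-].
pose dist := inf D.
have dist_le u : X u -> dist <= `|y - u|.
  by move=> Xu; apply: (ge_inf hD.2); exists u.
have dist0 : 0 <= dist by apply: lb_le_inf; [exact: hD.1|move=> _ [u _ <-]].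
have /choice[u hu] n : exists u, X u /\ `|y - u| < dist + n.+1%:R^-1.
  have n0 : 0 < n.+1%:R^-1 :> R by rewrite invr_gt0.
  by have [_ [v Xv <-] hv] := inf_adherent n0 hD; exists v.
have close e : 0 < e -> exists N, forall n, (N <= n)%N -> `|y - u n| < dist + e.
  move=> /invS_small[N hN]; exists N => n Nn.
  by have [_ /lt_trans] := hu n; apply; rewrite ltrD2l hN.
have [|l hl] := @cauchy_seq_limit _ _ u.
  move=> e e0.
  (* with a, b <= dist + h and |a + b| >= 2 dist, the parallelogram law gives
     |a - b|^2 <= 8 dist h + 4 h^2 < c h when h <= 1 *)
  pose c := 8 * dist + 5; have c0 : 0 < c by rewrite /c; lra.
  pose h := Num.min 1 (e ^+ 2 / c).
  have h0 : 0 < h by rewrite lt_min ltr01 divr_gt0// exprn_gt0.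
  have h1 : h <= 1 by rewrite ge_min lexx.
  have hc : h * c <= e ^+ 2 by rewrite -ler_pdivlMr// ge_min lexx orbT.
  have [N hN] := close h h0; exists N => m n Nm Nn.
  rewrite -(@ltr_pXn2r _ 2)// ?nnegrE ?(ltW e0)//.
  have mid : X (2^-1 *: (u m + u n)).
    by apply: csubZ => //; apply: csubD => //; apply: (hu _).1.
  have := dist_le _ mid; have := hN _ Nm; have := hN _ Nn.
  set a := y - u n; set b := y - u m.
  have -> : y - 2^-1 *: (u m + u n) = 2^-1 *: (a + b).
    rewrite /a /b addrACA -opprD -mulr2n -[y *+ 2]scaler_nat scalerBr scalerA.
    by rewrite mulVf// scale1r (addrC (u n)).
  have -> : u m - u n = a - b by rewrite /a /b opprB [RHS]addrC addrA addrNK.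
  move=> ha hb; rewrite normrZ ger0_norm ?invr_ge0// => hm.
  have key : `|a - b| ^+ 2 + `|a + b| ^+ 2 = 2 * (`|a| ^+ 2 + `|b| ^+ 2).
    by rewrite sqr_normB sqr_normD; ring.
  have hm2 : 2 * dist <= `|a + b| by lra.
  have hm3 : (2 * dist) ^+ 2 <= `|a + b| ^+ 2.
    by rewrite ler_sqr ?nnegrE ?mulr_ge0.
  have ha2 : `|a| ^+ 2 < (dist + h) ^+ 2.
    by rewrite ltr_pXn2r// ?nnegrE ?addr_ge0 ?(ltW h0).
  have hb2 : `|b| ^+ 2 < (dist + h) ^+ 2.
    by rewrite ltr_pXn2r// ?nnegrE ?addr_ge0 ?(ltW h0).
  have hh : h ^+ 2 <= h by rewrite expr2 ler_piMl// ltW.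
  move: hc; rewrite /c => hc.
  have e1 : (dist + h) ^+ 2 = dist ^+ 2 + 2 * (h * dist) + h ^+ 2 by ring.
  have e2 : (2 * dist) ^+ 2 = 4 * dist ^+ 2 by ring.
  have e3 : h * (8 * dist + 5) = 8 * (h * dist) + 5 * h by ring.
  rewrite e1 in ha2 hb2; rewrite e2 in hm3; rewrite e3 in hc.
  lra.
have Xl : X l.
  case: (cX) => /closed_approx + _ _; apply => e e0.
  have [N hN] := hl e e0; exists (u N); last exact: hN.
  exact: (hu N).1.
exists l => // v Xv; apply: le_trans (dist_le _ Xv).
apply/ler_addgt0Pr => e e0; have e2 := divr_gt0 e0 (ltr0Sn R 1).
have [N hN] := hl _ e2; have [N' hN'] := close _ e2.
have h1 := hN _ (leq_maxl N N'); have h2 := hN' _ (leq_maxr N N').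
have : `|y - l| <= `|y - u (maxn N N')| + `|l - u (maxn N N')|.
  rewrite -(normrN (l - _)) opprB; apply: le_trans (ler_normD _ _).
  by rewrite addrA addrNK.
lra.
Qed.

(** The value of [orth_proj] is a chosen point; that one exists is the projection
theorem. *)
Lemma orth_proj_spec X y : closed_subspace X ->
  X (orth_proj X y) /\ forall u, X u -> inner u (y - orth_proj X y) = 0.
Proof.
move=> cX.
suff : exists x, [set x | X x /\ forall u, X u -> inner u (y - x) = 0] x.
  by move=> /xgetPex -/(_ 0).
have [l Xl hl] := nearest_point y cX; exists l; split=> // u Xu.
(* t approximates the minimizer of |w - t u|; the summand 1 avoids u = 0 *)
set w := y - l; pose s := inner u w; pose t := s / (`|u| ^+ 2 + 1).
have N1 : 0 < `|u| ^+ 2 + 1 by rewrite ltr_wpDl// exprn_ge0.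
have : `|w| ^+ 2 <= `|w - t *: u| ^+ 2.
  rewrite ler_sqr ?nnegrE//; have := hl (l + t *: u); rewrite opprD addrA.
  by apply; apply: csubD => //; apply: csubZ.
rewrite sqr_normB innerZr innerC -/s normrZ exprMn real_normK ?num_real// => h.
have st : s = t * (`|u| ^+ 2 + 1) by rewrite /t divfK// gt_eqF.
have u0 : 0 <= `|u| ^+ 2 by rewrite exprn_ge0.
have t2 : t ^+ 2 * (`|u| ^+ 2 + 2) <= 0.
  move: h; rewrite st.
  set a := `|u| ^+ 2; set b := `|w| ^+ 2 => h.
  have : b - (t * (t * (a + 1))) *+ 2 + t ^+ 2 * a - b =
         - (t ^+ 2 * (a + 2)) by ring.
  lra.
have : t ^+ 2 = 0.
  apply/eqP; rewrite eq_le sqr_ge0 andbT.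
  by rewrite -(pmulr_lle0 _ (_ : 0 < `|u| ^+ 2 + 2))// ltr_wpDl.
by move/eqP; rewrite sqrf_eq0 => /eqP t0; rewrite -/s st t0 mul0r.
Qed.

Section Fixed.
Variable X : set E.
Hypothesis cX : closed_subspace X.

Lemma orth_proj_in y : X (orth_proj X y).
Proof. exact: (orth_proj_spec y cX).1. Qed.

Lemma orth_projP y u : X u -> inner u (y - orth_proj X y) = 0.
Proof. exact: (orth_proj_spec y cX).2. Qed.

Lemma orth_proj_inner y u : X u -> inner (orth_proj X y) u = inner y u.
Proof.
move=> Xu; apply/esym/eqP; rewrite -subr_eq0 -innerBl innerC.
by rewrite orth_projP.
Qed.

Lemma orth_proj_uniq y x :
  X x -> (forall u, X u -> inner x u = inner y u) -> orth_proj X y = x.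
Proof.
move=> Xx h; apply/eqP; rewrite -subr_eq0; apply/eqP/inner_eq0.
have Xd : X (orth_proj X y - x) by apply: csubB => //; exact: orth_proj_in.
by rewrite {1}innerBl orth_proj_inner// h// subrr.
Qed.

Lemma orth_proj_id x : X x -> orth_proj X x = x.
Proof. by move=> Xx; apply: orth_proj_uniq. Qed.

Lemma orth_proj_eq0 y :
  orth_proj X y = 0 <-> forall u, X u -> inner y u = 0.
Proof.
split=> [h u Xu|h]; first by rewrite -orth_proj_inner// h inner0l.
apply: orth_proj_uniq => [|u Xu]; first by case: cX.
by rewrite inner0l h.
Qed.

Lemma orth_proj_norm y : `|orth_proj X y| <= `|y|.
Proof.
have [->//|p0] := eqVneq `|orth_proj X y| 0.
have pp : 0 < `|orth_proj X y| by rewrite lt_def p0/=.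
rewrite -(ler_pM2r pp) -expr2 -innerxx orth_proj_inner ?inner_le//.
exact: orth_proj_in.
Qed.

Lemma orth_proj_bounded : bounded_map (orth_proj X).
Proof.
split=> [k x y|]; last by exists 1 => // x; rewrite mul1r orth_proj_norm.
apply: orth_proj_uniq.
  by case: (cX) => _ _; apply; exact: orth_proj_in.
by move=> u Xu; rewrite !innerDl !innerZl !orth_proj_inner.
Qed.

(** The representative is a multiple of the component [w], orthogonal to the kernel
of [f], of a vector on which [f] does not vanish. *)
Lemma riesz (f : E -> R) :
  (forall k x y, X x -> X y -> f (k *: x + y) = k * f x + f y) ->
  (exists M, forall x, X x -> `|f x| <= M * `|x|) ->
  exists2 x, X x & forall u, X u -> inner u x = f u.
Proof.
move=> lf [M hM].
have X0 : X 0 by case: cX.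
have XD k x y : X x -> X y -> X (k *: x + y) by case: cX => _ _; apply.
have f0 : f 0 = 0 by have := lf 1 0 0 X0 X0; rewrite scale1r addr0 mul1r; lra.
have fZ k x : X x -> f (k *: x) = k * f x.
  by move=> Xx; rewrite -[in LHS](addr0 (k *: x)) lf// f0 addr0.
have [h0|/existsNP[v /not_implyP[Xv /eqP fv]]] := pselect (forall u, X u -> f u = 0).
  by exists 0 => // u Xu; rewrite inner0r h0.
pose N := [set x | X x /\ f x = 0].
have cN : closed_subspace N by apply: (@csub_kernel _ _ R^o) => //; exists M.
have [Np Nort] := orth_proj_spec v cN.
set w := v - orth_proj N v in Nort.
have Xw : X w by apply: csubB => //; exact: Np.1.
have fw : f w != 0.
  have -> : w = (-1) *: orth_proj N v + v by rewrite scaleN1r addrC.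
  by rewrite lf//; [rewrite Np.2 mulr0 add0r|exact: Np.1].
have w0 : `|w| != 0.
  by apply: contra fw; rewrite normr_eq0 => /eqP ->; rewrite f0.
exists ((f w / `|w| ^+ 2) *: w) => [|u Xu]; first exact: csubZ.
have hN : N ((- (f u / f w)) *: w + u).
  by split; [exact: XD|rewrite lf// mulNr divfK// addrC subrr].
have := Nort _ hN; rewrite innerDl innerZl innerxx innerZr => h.
have -> : inner u w = f u / f w * `|w| ^+ 2 by lra.
by field; rewrite w0 fw.
Qed.

(** Since [adjoint_on] is 0 by default, the direct implication needs the adjoint to
exist, that is, [riesz]. *)
Lemma adjoint_on_eq0 (F : hilbertType R) (Y : set F) (f : E -> F) (y : F) :
  bounded_linear_on X Y f ->
  adjoint_on X f y = 0 <-> forall u, X u -> inner (f u) y = 0.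
Proof.
move=> [_ lf [M hM]]; have X0 : X 0 by case: cX.
have spec : exists x, X x /\ forall u, X u -> inner u x = inner (f u) y.
  have [| |x Xx hx] := @riesz (fun u => inner (f u) y); last by exists x.
    by move=> k x z Xx Xz; rewrite lf// innerDl innerZl.
  exists (M * `|y|) => x Xx; rewrite (le_trans (cauchy_schwarz _ _))//.
  by rewrite mulrAC ler_wpM2r// hM.
have := xgetPex 0 spec; rewrite -/(adjoint_on X f y) => -[Xa ha].
split=> [a0 u Xu|h]; first by rewrite -ha// a0 inner0r.
by apply: inner_eq0; rewrite ha// h.
Qed.

End Fixed.
End Projection.

Lemma adjoint_exists (R : realType) (E F : hilbertType R) (f : E -> F) :
  bounded_map f ->
  exists2 g : F -> E, bounded_map g & forall x y, inner (f x) y = inner x (g y).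
Proof.
move=> bf; have [M M0 hM] := bf.2.
have cT := @csub_setT _ E.
have /choice[g hg] y : exists z, forall x, inner x z = inner (f x) y.
  have [| |z _ hz] := @riesz _ _ _ cT (fun u => inner (f u) y).
  - by move=> k x z _ _; rewrite bf.1 innerDl innerZl.
  - exists (M * `|y|) => x _; rewrite (le_trans (cauchy_schwarz _ _))//.
    by rewrite mulrAC ler_wpM2r.
  - by exists z => x; rewrite hz.
exists g; last by move=> x y; rewrite hg.
split=> [k x y|].
  apply/eqP; rewrite -subr_eq0; apply/eqP/inner_eq0.
  by rewrite innerBr innerDr innerZr !hg innerDr innerZr subrr.
exists M => // x; have [->|g0] := eqVneq `|g x| 0; first by rewrite mulr_ge0.
have gp : 0 < `|g x| by rewrite lt_def g0/=.
rewrite -(ler_pM2r gp) -expr2 -innerxx hg (le_trans (inner_le _ _))//.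
by rewrite mulrAC ler_wpM2r.
Qed.

(** * Extension of orthogonal families to bounded maps *)

Section IsometricExtension.
Context {R : realType} {T : Type} {E F : hilbertType R}.
Variables (D : set T) (e : T -> E) (f : T -> F) (k : R).
Hypothesis k0 : 0 <= k.
Hypothesis span_e : closed_span (e @` D) = setT.
Hypothesis inner_f : forall s t, D s -> D t ->
  inner (f s) (f t) = k * inner (e s) (e t).

(** The graph of the linear extension of [e s |-> f s] to finite linear combinations,
as a relation: that it is single-valued is a consequence of [span_graph_norm]. *)
Inductive span_graph : E -> F -> Prop :=
| span_graph0 : span_graph 0 0
| span_graphS c s x y : D s -> span_graph x y ->
    span_graph (c *: e s + x) (c *: f s + y).

Lemma span_graph_lin c x y x' y' : span_graph x y -> span_graph x' y' ->
  span_graph (c *: x + x') (c *: y + y').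
Proof.
move=> gxy gxy'; elim: gxy => [|b s u v Ds _ ih]; first by rewrite !scaler0 !add0r.
by rewrite !scalerDr !scalerA -!addrA; apply: span_graphS.
Qed.

(** Inner products are computed by induction on one argument at a time; the
case of a generator against a combination comes first. *)
Lemma span_graph_norm x y : span_graph x y -> `|y| = Num.sqrt k * `|x|.
Proof.
have h s u v : D s -> span_graph u v -> inner (f s) v = k * inner (e s) u.
  move=> Ds; elim=> [|c t {}u {}v Dt _ ih]; first by rewrite !inner0r mulr0.
  by rewrite !innerDr !innerZr ih inner_f//; ring.
have h2 u v : span_graph u v -> forall u' v', span_graph u' v' ->
    inner v v' = k * inner u u'.
  elim=> [|c t {}u {}v Dt _ ih] u' v' g; first by rewrite !inner0l mulr0.
  by rewrite !innerDl !innerZl (ih _ _ g) (h _ _ _ Dt g); ring.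
move=> g; apply/eqP; rewrite -(@eqrXn2 _ 2) ?mulr_ge0//.
by rewrite exprMn sqr_sqrtr// -!innerxx (h2 _ _ g _ _ g).
Qed.

Lemma span_graph_dense x eps : 0 < eps ->
  exists uv : E * F, span_graph uv.1 uv.2 /\ `|x - uv.1| < eps.
Proof.
move=> eps0; pose X := [set u | exists v, span_graph u v].
have cX : closed_subspace (closure X).
  apply: closure_csub; first by exists 0; exact: span_graph0.
  by move=> c u u' [v g] [v' g']; exists (c *: v + v'); exact: span_graph_lin.
have : closed_span (e @` D) x by rewrite span_e.
have /[apply] : closed_span (e @` D) `<=` closure X.
  apply: closed_span_sub => // _ [s Ds <-]; apply: subset_closure.
  exists (1 *: f s + 0); rewrite -[e s]addr0 -[e s]scale1r.
  by apply: span_graphS => //; exact: span_graph0.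
by move=> /closure_approx/(_ _ eps0)[u [v g] xu]; exists (u, v).
Qed.

Let lim_graph (x : E) (y : F) := exists u v, [/\ forall n, span_graph (u n) (v n),
  u n @[n --> \oo] --> x & v n @[n --> \oo] --> y].

(** An orthogonal family with vectors of the same length [sqrt k] is the image of an
orthonormal basis under a bounded map: by [span_graph_norm] the closure of
[span_graph] is the graph of a map, everywhere defined by [span_graph_dense] and
completeness. *)
Lemma isometric_extension : exists2 L : E -> F, bounded_map L &
  forall s, D s -> L (e s) = f s.
Proof.
have lg_lin c x y x' y' : lim_graph x y -> lim_graph x' y' ->
    lim_graph (c *: x + x') (c *: y + y').
  move=> [u [v [g ux vy]]] [u' [v' [g' ux' vy']]].
  exists (fun n => c *: u n + u' n), (fun n => c *: v n + v' n); split.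
  - by move=> n; exact: span_graph_lin.
  - by apply: cvgD => //; apply: cvgZ => //; exact: cvg_cst.
  - by apply: cvgD => //; apply: cvgZ => //; exact: cvg_cst.
have lg_norm x y : lim_graph x y -> `|y| = Num.sqrt k * `|x|.
  move=> [u [v [g ux vy]]].
  have h1 : `|v n| @[n --> \oo] --> `|y| by exact: cvg_norm.
  have h2 : `|v n| @[n --> \oo] --> Num.sqrt k * `|x|.
    rewrite (_ : (fun n => `|v n|) = fun n => Num.sqrt k * `|u n|).
      by apply: cvgM; [exact: cvg_cst|exact: cvg_norm].
    by apply/funext => n; rewrite (span_graph_norm (g n)).
  by apply: (cvg_unique _ h1 h2); exact: norm_hausdorff.
have /choice[L hL] x : exists y, lim_graph x y.
  have /choice[uv huv] n : exists uv : E * F,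
      span_graph uv.1 uv.2 /\ `|x - uv.1| < n.+1%:R^-1.
    by apply: span_graph_dense; rewrite invr_gt0.
  have close eps : 0 < eps ->
      exists N, forall n, (N <= n)%N -> `|x - (uv n).1| < eps.
    move=> /invS_small[N hN]; exists N => n Nn.
    by have [_ /lt_trans] := huv n; apply; exact: hN.
  have [|l hl] := @cauchy_seq_limit _ _ (fun n => (uv n).2).
    move=> eps eps0; have s0 : 0 < 2 * (Num.sqrt k + 1).
      by rewrite mulr_gt0// ltr_wpDl// sqrtr_ge0.
    have [N hN] := close _ (divr_gt0 eps0 s0); exists N => m n Nm Nn.
    have -> : (uv m).2 - (uv n).2 = -1 *: (uv n).2 + (uv m).2.
      by rewrite scaleN1r addrC.
    rewrite (span_graph_norm (span_graph_lin _ (huv n).1 (huv m).1)).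
    rewrite scaleN1r (_ : - _ + _ = (x - (uv n).1) - (x - (uv m).1)).
      have := ler_normB (x - (uv n).1) (x - (uv m).1).
      have := hN _ Nm; have := hN _ Nn.
      set a := `|_ - (uv n).1|; set b := `|_ - (uv m).1| => ha hb hab.
      have hs : a + b < eps / (Num.sqrt k + 1).
        have -> : eps / (Num.sqrt k + 1) = eps / (2 * (Num.sqrt k + 1)) *+ 2.
          by field; rewrite gt_eqF//; move: s0; rewrite pmulr_rgt0.
        lra.
      have s1 : 0 < Num.sqrt k + 1 by rewrite ltr_wpDl// sqrtr_ge0.
      move: hs; rewrite ltr_pdivlMr//; apply: le_lt_trans.
      apply: (@le_trans _ _ (Num.sqrt k * (a + b))).
        by rewrite ler_wpM2l// sqrtr_ge0.
      rewrite mulrC ler_wpM2l ?lerDl//.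
      by rewrite addr_ge0 ?normr_ge0.
    by rewrite opprB [RHS]addrC addrA addrNK [RHS]addrC.
  exists l, (fun n => (uv n).1), (fun n => (uv n).2); split.
  - by move=> n; exact: (huv n).1.
  - apply/cvgrPdist_lt => eps eps0; have [N hN] := close eps eps0.
    by exists N.
  - apply/cvgrPdist_lt => eps eps0; have [N hN] := hl eps eps0.
    by exists N.
have lg_uniq x y y' : lim_graph x y -> lim_graph x y' -> y = y'.
  move=> g g'; have := lg_norm _ _ (lg_lin (-1) _ _ _ _ g' g).
  rewrite !scaleN1r addNr normr0 mulr0 => /eqP.
  by rewrite normr_eq0 addrC subr_eq0 => /eqP.
exists L.
  split=> [c x y|]; first by apply: lg_uniq; [exact: hL|exact: lg_lin].
  by exists (Num.sqrt k); [exact: sqrtr_ge0|move=> x; rewrite (lg_norm x)].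
move=> s Ds; apply: lg_uniq; first exact: hL.
exists (fun=> 1 *: e s + 0), (fun=> 1 *: f s + 0); rewrite !addr0 !scale1r; split.
- move=> _; rewrite -[e s]addr0 -[e s]scale1r -[f s]addr0 -[f s]scale1r.
  by apply: span_graphS => //; exact: span_graph0.
- exact: cvg_cst.
- exact: cvg_cst.
Qed.

End IsometricExtension.

(** * Quadratic forms on orthogonal sums *)

Section Blocks.
Context {R : realType} {I : eqType} {E F : hilbertType R}.
Variables (X : I -> set E) (T : E -> F).
Hypothesis cX : forall i, closed_subspace (X i).
Hypothesis bT : bounded_map T.
Hypothesis orthX : forall i j x y, i != j -> X i x -> X j y -> inner x y = 0.
Hypothesis orthT : forall i j x y, i != j -> X i x -> X j y ->
  inner (T x) (T y) = 0.

Let P i := orth_proj (X i).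
Let V := closed_span (\bigcup_i X i).

Let proj_other i j x : i != j -> X j x -> P i x = 0.
Proof.
move=> ij Xx; apply/orth_proj_eq0 => // u Xu.
by rewrite (orthX _ Xx Xu)// eq_sym.
Qed.

(** [T] maps the blocks to orthogonal sets, so only the component in [X i] is seen by
[T y] when [y] is in [X i]. *)
Lemma block_cross i x y : V x -> X i y ->
  inner (T x) (T y) = inner (T (P i x)) (T y).
Proof.
move=> Vx Xy.
have bP : bounded_map (T \o (fun x => x - P i x)).
  apply: bounded_comp => //; apply: bounded_sub; first exact: bounded_id.
  exact: orth_proj_bounded.
apply/eqP; rewrite -subr_eq0 -innerBl -bmapB//; apply/eqP.
apply: (bmap_orth_span bP _ Vx) => u [j _ Xu] /=.
have [ij|ij] := eqVneq i j.
  rewrite /P orth_proj_id ?subrr ?(bmap0 bT) ?inner0l// ij; exact: Xu.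
by rewrite (proj_other ij Xu) subr0 (orthT _ Xu Xy)// eq_sym.
Qed.

(** The vector that remains when the components of [x] along the blocks listed in [l]
are removed; repetitions are harmless. *)
Let residual l x := foldr (fun i x => x - P i x) x l.

Let residualB l x y : residual l (x - y) = residual l x - residual l y.
Proof.
elim: l => //= i l ->; rewrite /P (bmapB _ _ (orth_proj_bounded (cX i))).
by rewrite opprD addrACA -opprD opprB addrACA -opprD.
Qed.

Let residualP l j x : residual l (P j x) = P j (residual l x).
Proof.
elim: l => //= i l ->; rewrite /P (bmapB _ _ (orth_proj_bounded (cX j))) -/(P _ _).
congr (_ - _); have [->//|ij] := eqVneq i j.
rewrite -!/(P _ _) (proj_other ij (orth_proj_in (cX j) _)).
rewrite -/(P j _) (proj_other _ (orth_proj_in (cX i) _))// eq_sym//.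
Qed.

Let residualC l l' x : residual l (residual l' x) = residual l' (residual l x).
Proof. by elim: l' => //= i l' <-; rewrite residualB residualP. Qed.

Let residual_norm l x : `|residual l x| <= `|x|.
Proof.
elim: l => //= i l; apply: le_trans; set y := residual l x.
rewrite -(@ler_pXn2r _ 2)// ?nnegrE// sqr_normB.
have -> : inner y (P i y) = `|P i y| ^+ 2.
  by rewrite -innerxx [RHS](orth_proj_inner (cX i))//; exact: orth_proj_in.
have := exprn_ge0 2 (normr_ge0 (P i y)); lra.
Qed.

Let residual_lin l k x y :
  residual l (k *: x + y) = k *: residual l x + residual l y.
Proof.
elim: l => //= i l ->; have bP := orth_proj_bounded (cX i).
by rewrite /P bP.1 opprD addrACA -scalerBr.
Qed.

(** Finitely many blocks approximate a vector of the closed sum. Residuals commute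
and contract, hence the vectors with this property form a closed subspace. *)
Lemma block_residual_small x e : V x -> 0 < e ->
  exists l, `|residual l x| < e.
Proof.
pose W := [set x | forall e, 0 < e ->
  exists l, `|residual l x| < e].
suff VW : V `<=` W by move=> Vx; exact: VW.
apply: closed_span_sub.
  split.
  - apply/closed_approx => {}x h {}e e0.
    have e2 := divr_gt0 e0 (ltr0Sn R 1).
    have [y Wy xy] := h _ e2; have [l ly] := Wy _ e2.
    exists l => //; rewrite -[x](subrK y) -[x - y]scale1r residual_lin scale1r.
    rewrite (le_lt_trans (ler_normD _ _))// (splitr e) ltr_leD ?(ltW ly)//.
    exact: le_lt_trans (residual_norm _ _) xy.
  - move=> {}e e0; exists [::] => //=; by rewrite normr0.
  - move=> k {}x y Wx Wy {}e e0.
    have e1 : 0 < e / 2 / (`|k| + 1) by rewrite !divr_gt0// ltr_wpDl.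
    have [l lx] := Wx _ e1; have [l' ly] := Wy _ (divr_gt0 e0 (ltr0Sn R 1)).
    exists (l ++ l').
    rewrite /residual foldr_cat -/(residual _ _) -/(residual _ _) residual_lin.
    rewrite residual_lin (le_lt_trans (ler_normD _ _))// (splitr e) ler_ltD//.
      rewrite normrZ residualC.
      apply: (@le_trans _ _ (`|k| * `|residual l x|)).
        by rewrite ler_wpM2l// residual_norm.
      move: lx; rewrite ltr_pdivlMr ?ltr_wpDl// => /ltW; apply: le_trans.
      by rewrite mulrC ler_wpM2l// lerDl.
    exact: le_lt_trans (residual_norm _ _) ly.
move=> u [i _ Xu] {}e e0; exists [:: i].
by rewrite /= /P orth_proj_id// subrr normr0.
Qed.

Variable r : R.
Let q x := `|T x| ^+ 2 - r * `|x| ^+ 2.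

Lemma block_quad_split i x : V x -> q x = q (P i x) + q (x - P i x).
Proof.
move=> Vx; have Xp := orth_proj_in (cX i) x; rewrite /q -/(P i x).
rewrite bmapB// !sqr_normB (block_cross Vx Xp) -/(P i x).
by rewrite -(orth_proj_inner (cX i) x Xp) -/(P i x) !innerxx; ring.
Qed.

Let block_sub i x : V x -> V (x - P i x).
Proof.
move=> Vx; apply: (csubB (closed_spanP _) Vx).
by apply: sub_closed_span; exists i => //; exact: orth_proj_in.
Qed.

Let good x := V x /\ forall i, 0 <= q (P i x).

Let good_sub i x : good x -> good (x - P i x).
Proof.
move=> [Vx gx]; split=> [|j]; first exact: block_sub.
rewrite /P bmapB; last exact: orth_proj_bounded.
rewrite -!/(P _ _); have [ij|ij] := eqVneq j i.
  rewrite ij {2}/P orth_proj_id//; last exact: (orth_proj_in (cX i)).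
  by rewrite subrr /q bmap0// !normr0 expr0n mulr0 subr0.
rewrite (proj_other ij (orth_proj_in (cX i) x)).
by rewrite subr0; exact: gx.
Qed.

(** Removing a component on which [q] is nonnegative does not increase [q], while
[q] is at least [- |r| e ^+ 2] on residuals of norm at most [e]. *)
Lemma block_quad_ge0 x : V x -> (forall i, 0 <= q (P i x)) -> 0 <= q x.
Proof.
move=> Vx gx.
have step l y : good y ->
    good (residual l y) /\ q (residual l y) <= q y.
  elim: l => [//|i l ih] gy /=; have [g h] := ih gy.
  split; first exact: good_sub.
  by apply: le_trans h; rewrite (block_quad_split i g.1) lerDr g.2.
apply/ler_addgt0Pr => e e0.
have r0 : 0 < `|r| + 1 by rewrite ltr_wpDl.
have h0 : 0 < Num.min 1 (e / (`|r| + 1)) by rewrite lt_min ltr01 divr_gt0.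
have [l] := block_residual_small Vx h0.
have [_ hq] := step l x (conj Vx gx).
set y := residual l x in hq *; rewrite lt_min => /andP[y1 ye].
have hy : `|r| * `|y| ^+ 2 <= e.
  apply: (@le_trans _ _ ((`|r| + 1) * `|y|)).
    apply: ler_pM => //; first by rewrite lerDl.
    by rewrite expr2 ler_piMl// ltW.
  by move: ye; rewrite ltr_pdivlMr// mulrC => /ltW.
have : r * `|y| ^+ 2 <= `|r| * `|y| ^+ 2.
  by rewrite ler_wpM2r ?ler_norm// exprn_ge0.
have : 0 <= `|T y| ^+ 2 by rewrite exprn_ge0.
move: hq; rewrite {1}/q; lra.
Qed.

(** The form of a strict inequality for infinitely many blocks: one block with
[0 < q] makes [q x] positive, whatever the infimum over all blocks. *)
Lemma block_quad_ge x i : V x -> (forall i, 0 <= q (P i x)) ->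
  q (P i x) <= q x.
Proof.
move=> Vx gx; rewrite (block_quad_split i Vx) lerDl.
by have [] := good_sub i (conj Vx gx); exact: block_quad_ge0.
Qed.

End Blocks.

(** * Maps and cohomology of complexes *)

Section BoundedLinearOn.
Context {R : realType} {E F : hilbertType R}.

Lemma blin_of_bounded_map (X : set E) (Y : set F) (f : E -> F) : bounded_map f ->
  (forall x, X x -> Y (f x)) -> bounded_linear_on X Y f.
Proof.
move=> [lf [M _ hM]] fXY; split=> [//|k x y _ _|]; first exact: lf.
by exists M => x _; exact: hM.
Qed.

Lemma blin_eq_span (A : set E) (Y : set F) (f g : E -> F) : bounded_map g ->
  bounded_linear_on (closed_span A) Y f -> (forall x, A x -> f x = g x) ->
  forall x, closed_span A x -> f x = g x.
Proof.
move=> bg [_ lf [M hM]] fg x Ax.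
have cX : closed_subspace [set x | closed_span A x /\ f x - g x = 0].
  apply: csub_kernel; first exact: closed_spanP.
    by move=> k u v Au Av; rewrite lf// bg.1 scalerBr opprD addrACA.
  have [N _ hN] := bg.2; exists (M + N) => u Au.
  by rewrite mulrDl (le_trans (ler_normB _ _))// lerD// hM.
apply/eqP; rewrite -subr_eq0; apply/eqP.
suff [] : [set x | closed_span A x /\ f x - g x = 0] x by [].
apply: (closed_span_sub cX) Ax => u Au; split; first exact: sub_closed_span.
by rewrite fg// subrr.
Qed.

Lemma blin_restrict (X X' : set E) (Y Y' : set F) (f : E -> F) : X' `<=` X ->
  (forall x, X' x -> Y' (f x)) -> bounded_linear_on X Y f -> bounded_linear_on X' Y' f.
Proof.
move=> XX' fY [_ lf [M hM]]; split=> // [k x y Xx Xy|].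
  by rewrite lf//; exact: XX'.
by exists M => x Xx; apply: hM; exact: XX'.
Qed.

End BoundedLinearOn.

Section Acyclicity.
Context {R : realType} {Em E0 E1 : hilbertType R}.
Variable C : complex3 Em E0 E1.
Hypothesis hC : is_complex3 C.

Lemma ker1_csub : closed_subspace (ker1 C).
Proof. by case: hC => -[_ c0 _] _ [_ lf bf] _; exact: csub_kernel. Qed.

Lemma closure_im0_csub : closed_subspace (closure (map0 C @` spm C)).
Proof.
case: hC => -[[_ Cm0 CmD] _ _] [_ lf _] _ _.
apply: closure_csub.
  exists 0 => //; have := lf 1 0 0 Cm0 Cm0; rewrite !scale1r addr0.
  by move=> /esym/eqP; rewrite -subr_eq0 addrK => /eqP.
move=> k _ _ [x Cx <-] [y Cy <-]; exists (k *: x + y); first exact: CmD.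
by rewrite lf.
Qed.

Lemma closure_im0_sub : closure (map0 C @` spm C) `<=` ker1 C.
Proof.
have [cK _ _] := ker1_csub; rewrite [X in _ `<=` X](iffLR (closure_id _) cK).
apply: closureS => _ [x Cx <-]; case: hC => _ [f0 _ _] _ h.
by split; [exact: f0|exact: h].
Qed.

(** The kernel splits orthogonally into the closure of the image and the harmonic
vectors. *)
Lemma H0_eq0_of_harmonic :
  (forall x, ker1 C x -> (forall u, spm C u -> inner (map0 C u) x = 0) -> x = 0) ->
  H0_eq0 C.
Proof.
move=> h; apply/seteqP; split; last exact: closure_im0_sub.
move=> x Kx; have cI := closure_im0_csub.
have pI := orth_proj_in cI x; set p := orth_proj _ x in pI.
rewrite (_ : x = p)//; apply/eqP; rewrite -subr_eq0; apply/eqP.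
apply: h; first by apply: (csubB ker1_csub Kx); exact: closure_im0_sub.
move=> u Cu; apply: (orth_projP cI x); apply: subset_closure; exact: imageP.
Qed.

End Acyclicity.

(** * Sums over finite sets *)

Section FiniteSums.
Context {R : realType}.

Lemma fsum_pair (V : nmodType) (T : choiceType) (x y : T) (g : T -> V) : x != y ->
  \sum_(i \in [set x; y]) g i = g x + g y.
Proof.
move=> xy; rewrite fsbigU0 ?fsbig_set1//.
by move=> _ [->] /= xy'; rewrite xy' eqxx in xy.
Qed.

Lemma fsum_const (T : choiceType) (A : set T) n (k : R) : A #= `I_n ->
  \sum_(i \in A) k = n%:R * k.
Proof.
move=> An; have fA : finite_set A by exists n.
rewrite fsbig_finite// big_const_seq count_predT iter_addr_0 mulr_natl.
by congr (_ *+ _); exact: card_fset_set An.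
Qed.

Lemma fsum_single (V : nmodType) (T : choiceType) (A : set T) j (g : T -> V) :
  A j -> (forall i, A i -> i != j -> g i = 0) -> \sum_(i \in A) g i = g j.
Proof.
move=> Aj h; rewrite -(fsbig_widen [set j] A) ?fsbig_set1//; first by move=> _ ->.
by move=> i [Ai ij]; apply: h => //; exact/eqP.
Qed.

Context {E : hilbertType R}.

Lemma inner_fsuml (T : choiceType) (A : set T) (f : T -> E) y : finite_set A ->
  inner (\sum_(i \in A) f i) y = \sum_(i \in A) inner (f i) y.
Proof. by move=> fA; rewrite !fsbig_finite// inner_suml. Qed.

Lemma inner_fsumr (T : choiceType) (A : set T) (f : T -> E) y : finite_set A ->
  inner y (\sum_(i \in A) f i) = \sum_(i \in A) inner y (f i).
Proof. by move=> fA; rewrite !fsbig_finite// inner_sumr. Qed.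

Lemma bmap_fsum (F : hilbertType R) (f : E -> F) (T : choiceType) (A : set T)
    (g : T -> E) : bounded_map f -> finite_set A ->
  f (\sum_(i \in A) g i) = \sum_(i \in A) f (g i).
Proof. by move=> bf fA; rewrite !fsbig_finite// (bmap_sum _ _ _ bf). Qed.

Lemma csub_fsum (X : set E) (T : choiceType) (A : set T) (g : T -> E) :
  closed_subspace X -> (forall i, A i -> X (g i)) -> X (\sum_(i \in A) g i).
Proof.
move=> cX h; have [fA|nfA] := pselect (finite_set (A `&` g @^-1` [set~ 0])).
  rewrite fsbig_supp fsbig_finite// big_seq; apply: csub_sum => // i.
  by rewrite in_fset_set// => /set_mem[/h].
by rewrite fsbig_dflt//; case: cX.
Qed.

End FiniteSums.

(** * Combinatorics of a Garland poset *)

Section PosetCombinatorics.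
Context {d : Order.disp_t} {S : porderType d}.
Variable P : garlandPoset S.
Local Notation lev := (level P).

(** The rank is only known to increase strictly along covers, and [x < y] refines to
covers when the interval is finite. *)
Lemma rho_lt x y : finite_set [set z | (x < z)%O /\ (z < y)%O] -> (x < y)%O ->
  rho P x < rho P y.
Proof.
have [n] := ubnP #|`fset_set [set z | (x < z)%O /\ (z < y)%O]|.
elim: n y => // n ih y hn fin xy.
have [cov|] := pselect (covers x y); first by have [] := rho_covers P cov.
move=> /not_andP[//|/existsNP[z /contrapT[xz zy]]].
apply: lt_le_trans (rho_homo P (ltW zy)).
have sub : [set w | (x < w)%O /\ (w < z)%O] `<=` [set w | (x < w)%O /\ (w < y)%O].
  by move=> w [xw wz]; split => //; exact: lt_trans zy.
have fin' := sub_finite_set sub fin.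
apply: ih => //; rewrite -ltnS; apply: leq_trans hn; rewrite ltnS.
apply: fproper_ltn_card; rewrite fproperE; apply/andP; split.
  by rewrite -fset_set_sub.
apply/negP; rewrite -fset_set_sub// => /(_ z); rewrite /= ltxx => h.
by have [] := h (conj xz zy).
Qed.

Lemma rho_cases x : [\/ lev (-1) x, lev 0 x | lev 1 x].
Proof.
rewrite /level/=; have /andP[] := rho_range P x.
have [->|h1] := eqVneq (rho P x) (-1); first by constructor.
have [->|h2] := eqVneq (rho P x) 0; first by constructor.
by move=> h3 h4; constructor 3; lia.
Qed.

Lemma finite_above a : lev (-1) a -> finite_set [set x | (a < x)%O].
Proof. by move=> /garlandP4[]. Qed.

Lemma finite_below b : lev 0 b -> finite_set [set x | (x < b)%O].
Proof. by move=> /garlandP1 h; exists (n0 P). Qed.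

Lemma rho_lt_above a x y : lev (-1) a -> (a <= x)%O -> (x < y)%O ->
  rho P x < rho P y.
Proof.
move=> la ax; apply: rho_lt; apply: sub_finite_set (finite_above la).
by move=> z /= [xz _]; exact: le_lt_trans xz.
Qed.

Lemma below_level b x : lev 0 b -> (x < b)%O -> lev (-1) x.
Proof.
move=> lb xb; have : rho P x < rho P b.
  by apply: rho_lt => //; apply: sub_finite_set (finite_below lb) => z [].
by rewrite lb; case: (rho_cases x) => [//|->|->].
Qed.

(** Levels are antichains above an element of level -1, where (P4) provides
finiteness. *)
Lemma same_level_eq i a x y : lev (-1) a -> (a <= x)%O -> (x <= y)%O ->
  lev i x -> lev i y -> x = y.
Proof.
move=> la ax; rewrite le_eqVlt => /predU1P[//|/(rho_lt_above la ax) + lx ly].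
by rewrite lx ly ltxx.
Qed.

Lemma covers_above a x y : lev (-1) a -> (a <= x)%O -> (x < y)%O ->
  rho P y = rho P x + 1 -> covers x y.
Proof.
move=> la ax xy h; split=> // z [xz zy].
have := rho_lt_above la ax xz.
have := rho_lt_above la (le_trans ax (ltW xz)) zy; lia.
Qed.

Definition between a c : set S := [set b | lev 0 b /\ (a < b)%O /\ (b < c)%O].

Lemma wgt_sqr a x y : lev (-1) a -> (a <= x)%O -> (x < y)%O ->
  rho P y = rho P x + 1 -> wgt P x y * wgt P x y = 1.
Proof. by move=> la ax xy h; have [->|->] := wgt_sign P (covers_above la ax xy h). Qed.

Lemma wgt_sqr01 a b c : lev (-1) a -> lev 1 c -> between a c b ->
  wgt P a b * wgt P a b = 1 /\ wgt P b c * wgt P b c = 1.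
Proof.
move=> la lc [lb [ab bc]]; split; apply: (@wgt_sqr a) => //.
- by rewrite lb la.
- exact: ltW.
- by rewrite lb lc.
Qed.

(** The two elements of (P5) are distinct, because a product of signs is not its own
opposite. *)
Lemma between_pair a c : lev (-1) a -> lev 1 c -> (a < c)%O ->
  exists b b', [/\ b != b', between a c = [set b; b'] &
    wgt P a b * wgt P b c = - (wgt P a b' * wgt P b' c)].
Proof.
move=> la lc ac; have [b [b' [e h]]] := garlandP5 la lc ac.
have eB : between a c = [set b; b'].
  rewrite -e; apply/seteqP; split=> x /=; first by case.
  move=> [ax xc]; split=> //; have := rho_lt_above la (lexx a) ax.
  have := rho_lt_above la (ltW ax) xc; rewrite la lc /level/=; lia.
exists b, b'; split=> //; apply: contra_eqN h => /eqP <-.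
have hb : between a c b by rewrite eB; left.
have [h1 h2] := wgt_sqr01 la lc hb.
by apply/eqP => h3; move: h1 h2; nia.
Qed.

Lemma finite_between a c : lev (-1) a -> finite_set (between a c).
Proof.
by move=> la; apply: sub_finite_set (finite_above la) => x [_ []].
Qed.

Definition above (i : int) x : set S := [set y | lev i y /\ (x <= y)%O].

Lemma finite_above_lev i a x : lev (-1) a -> (a <= x)%O -> i != -1 ->
  finite_set (above i x).
Proof.
move=> la ax ni; apply: sub_finite_set (finite_above la) => y [ly xy] /=.
rewrite lt_neqAle (le_trans ax xy) andbT; apply: contra ni => /eqP ay.
by rewrite -ly -ay la.
Qed.

Lemma lt_flag i a x : lev (-1) a -> lev i x -> (a <= x)%O -> i != -1 ->
  (a < x)%O.
Proof.
move=> la lx ax ni; rewrite lt_neqAle ax andbT; apply: contra ni => /eqP h.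
by rewrite -lx -h la.
Qed.

End PosetCombinatorics.

(** * Basis vectors and the generators of A and B *)

Lemma basis_ext (R : realType) (T : eqType) (E : hilbertType R) (D : set T)
    (e : T -> E) x y : orthonormal_basis D e ->
  (forall t, D t -> inner (e t) x = inner (e t) y) -> x = y.
Proof.
move=> [_ span_e] h; apply/eqP; rewrite -subr_eq0; apply/eqP/inner_eq0.
apply: (@orth_closed_span _ _ (e @` D)); last by rewrite span_e.
by move=> _ [t Dt <-]; rewrite innerBr h// subrr.
Qed.

Section LevelBasis.
Context {R : realType} {d : Order.disp_t} {S : porderType d}.
Variable P : garlandPoset S.
Context {E : hilbertType R}.
Variables (i : int) (z : S * S * S -> E).
Hypothesis hz : orthonormal_basis (triples P i) z.
Local Notation lev := (level P).

Definition below x : set S := [set a | lev (-1) a /\ (a <= x)%O].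

Lemma finite_below_lev x : lev i x -> finite_set (below x).
Proof.
case: (rho_cases P x) => [lx _|lx _|lx _].
- apply: sub_finite_set (finite_set1 x) => a [la ax].
  exact: (same_level_eq la (lexx _) ax la lx).
- apply: sub_finite_set (finite_below lx) => a [la ax] /=.
  by rewrite lt_neqAle ax andbT; apply/eqP => h; move: la; rewrite /level/= h lx.
- have f1 : finite_set [set a | rho P a = -1 /\ (a < x)%O].
    by exists (n1 P); exact: garlandP2.
  apply: sub_finite_set f1 => a [la ax]; split=> //.
  by rewrite lt_neqAle ax andbT; apply/eqP => h; move: la; rewrite /level/= h lx.
Qed.

Lemma inner_zpair a x a' x' c' : lev (-1) a -> lev i x -> (a <= x)%O ->
  triples P i (a', x', c') ->
  inner (z (a', x', c')) (zpair P z a x) = ((a' == a) && (x' == x))%:R.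
Proof.
move=> la lx ax tr; case: (tr) => la' lx' lc' ax' xc'.
rewrite /zpair inner_fsumr; last exact: (@finite_above_lev _ _ P 1 a).
have zt c : above P 1 x c -> triples P i (a', x', c') -> x' = x ->
    inner (z (a', x', c')) (z (a, x, c)) = ((a' == a) && (c' == c))%:R.
  by move=> [lc xc] _ ex; rewrite hz.1// !xpair_eqE ex eqxx andbT.
have [ex|xx] := eqVneq x' x; last first.
  rewrite andbF fsbig1// => c [lc xc].
  by rewrite hz.1// !xpair_eqE (negbTE xx) andbF.
rewrite andbT (fsum_single (j := c')) ?zt ?eqxx ?andbT//.
- by split; rewrite -?ex.
- by split; rewrite -?ex.
- by move=> c hc cc; rewrite zt// [c' == c]eq_sym (negbTE cc) andbF.
Qed.

Lemma inner_zpoint x a' x' c' : lev i x -> triples P i (a', x', c') ->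
  inner (z (a', x', c')) (zpoint P z x) = (x' == x)%:R.
Proof.
move=> lx tr; case: (tr) => la' lx' lc' ax' xc'.
rewrite /zpoint inner_fsumr; last exact: finite_below_lev.
have [ex|xx] := eqVneq x' x; last first.
  by rewrite fsbig1// => a [la ax]; rewrite inner_zpair// (negbTE xx) andbF.
rewrite (fsum_single (j := a')) ?inner_zpair -?ex ?eqxx//.
by move=> a [la ax] aa; rewrite inner_zpair -?ex// [a' == a]eq_sym (negbTE aa).
Qed.

(** The number of c of level 1 above x, as a real number: the square norm of z_ax. *)
Definition num_above x : R := \sum_(c \in above P 1 x) (1 : R).

Lemma num_above_gt0 a x c : lev (-1) a -> (a <= x)%O -> above P 1 x c -> 0 < num_above x.
Proof.
move=> la ax hc; have fA := @finite_above_lev _ _ P 1 a x la ax isT.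
by rewrite /num_above (fsbigD1 c)// ltr_wpDr// fsumr_ge0.
Qed.

Lemma inner_zpair_sum a x v : lev (-1) a -> lev i x -> (a <= x)%O ->
  inner (zpair P z a x) v = \sum_(c \in above P 1 x) inner (z (a, x, c)) v.
Proof.
by move=> la lx ax; rewrite inner_fsuml//; exact: (@finite_above_lev _ _ P 1 a).
Qed.

Lemma inner_zpair_zpoint a x x' : lev (-1) a -> lev i x -> (a <= x)%O ->
  lev i x' -> inner (zpair P z a x) (zpoint P z x') = (x == x')%:R * num_above x.
Proof.
move=> la lx ax lx'; rewrite inner_zpair_sum// /num_above mulr_fsumr.
by apply: eq_fsbigr => c /set_mem[lc xc]; rewrite inner_zpoint ?mulr1.
Qed.

Lemma inner_zpoint_sum x v : lev i x ->
  inner (zpoint P z x) v = \sum_(a \in below x) inner (zpair P z a x) v.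
Proof. by move=> lx; rewrite inner_fsuml//; exact: finite_below_lev. Qed.

Lemma inner_zpoint_zpoint x x' n : lev i x -> lev i x' -> below x #= `I_n ->
  inner (zpoint P z x) (zpoint P z x') = (x == x')%:R * (n%:R * num_above x).
Proof.
move=> lx lx' hn; rewrite inner_zpoint_sum//.
rewrite (eq_fsbigr (fun=> (x == x')%:R * num_above x)); last first.
  by move=> a /set_mem[la ax]; rewrite inner_zpair_zpoint.
by rewrite (fsum_const _ hn); ring.
Qed.

Lemma zpair_spA a x : lev (-1) a -> lev i x -> (a <= x)%O ->
  spA P i z (zpair P z a x).
Proof. by move=> la lx ax; apply: sub_closed_span; exists (a, x). Qed.

Lemma zpoint_spB x : lev i x -> spB P i z (zpoint P z x).
Proof. by move=> lx; apply: sub_closed_span; exists x. Qed.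

Lemma spB_sub_spA : spB P i z `<=` spA P i z.
Proof.
apply: closed_span_sub; first exact: closed_spanP.
move=> _ [x lx <-]; apply: csub_fsum; first exact: closed_spanP.
by move=> a [la ax]; exact: zpair_spA.
Qed.

End LevelBasis.

(** * The coboundaries as operators on the whole spaces *)

Section GarlandComplexes.
Context {R : realType} {d : Order.disp_t} {S : porderType d}.
Variable P : garlandPoset S.
Context {Em E0 E1 : hilbertType R}.
Variables (zm : S * S * S -> Em) (z0 : S * S * S -> E0) (z1 : S * S * S -> E1).
Hypothesis hzm : orthonormal_basis (triples P (-1)) zm.
Hypothesis hz0 : orthonormal_basis (triples P 0) z0.
Hypothesis hz1 : orthonormal_basis (triples P 1) z1.
Local Notation lev := (level P).
Local Notation w x y := ((wgt P x y)%:~R : R).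

Lemma triples_bot a x c : triples P (-1) (a, x, c) ->
  [/\ x = a, lev (-1) a, lev 1 c & (a < c)%O].
Proof.
move=> [la lx lc ax xc].
by rewrite -(same_level_eq la (lexx a) ax la lx) (lt_flag la lc)// (le_trans ax).
Qed.

Lemma triples_top a x c : triples P 1 (a, x, c) ->
  [/\ x = c, lev (-1) a, lev 1 c & (a < c)%O].
Proof.
move=> [la lx lc ax xc].
by rewrite (same_level_eq la ax xc lx lc) (lt_flag la lc)// (le_trans ax).
Qed.

Lemma triples_botP a c : lev (-1) a -> lev 1 c -> (a < c)%O ->
  triples P (-1) (a, a, c).
Proof. by move=> la lc ac; split=> //; exact: ltW. Qed.

Lemma triples_topP a c : lev (-1) a -> lev 1 c -> (a < c)%O ->
  triples P 1 (a, c, c).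
Proof. by move=> la lc ac; split=> //; exact: ltW. Qed.

Lemma triples_midP a b c : lev (-1) a -> lev 1 c ->
  triples P 0 (a, b, c) <-> between P a c b.
Proof.
move=> la lc; split=> [[_ lb _ ab bc]|[lb [ab bc]]]; last by split=> //; exact: ltW.
split=> //; split; first by rewrite (lt_flag la lb).
rewrite lt_neqAle bc andbT; apply/eqP => h.
by move: lc; rewrite -h /level/= lb.
Qed.

(** Vectors supported on the two triples (a, b, c) with given ends: the images of
z_aac under the first coboundary and of z_acc under the adjoint of the second one
have this form. *)
Definition fiber (g : S -> R) a c : E0 :=
  \sum_(b \in between P a c) g b *: z0 (a, b, c).

Lemma inner_fiber g a c a' b' c' : lev (-1) a -> lev 1 c -> (a < c)%O ->
  triples P 0 (a', b', c') ->
  inner (z0 (a', b', c')) (fiber g a c) = ((a' == a) && (c' == c))%:R * g b'.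
Proof.
move=> la lc ac tr; have fB := finite_between c la.
rewrite /fiber inner_fsumr//.
have [/andP[/eqP ea /eqP ec]|ne] := boolP (_ && _).
  subst a' c'; have bb : between P a c b' by apply/triples_midP.
  rewrite mul1r (fsum_single bb) ?innerZr ?hz0.1 ?eqxx ?mulr1//.
  move=> b hb bb'; rewrite innerZr hz0.1 ?triples_midP//.
  by rewrite !xpair_eqE !eqxx andbT/= eq_sym (negbTE bb') mulr0.
rewrite mul0r fsbig1// => b hb; rewrite innerZr hz0.1//; last exact/triples_midP.
rewrite !xpair_eqE (_ : _ && _ = false) ?mulr0//; apply: contraNF ne.
by move=> /andP[/andP[->]].
Qed.

Lemma inner_fiber2 g h a c a' c' : lev (-1) a -> lev 1 c -> (a < c)%O ->
  lev (-1) a' -> lev 1 c' -> (a' < c')%O ->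
  inner (fiber h a' c') (fiber g a c) =
  ((a' == a) && (c' == c))%:R * \sum_(b \in between P a' c') h b * g b.
Proof.
move=> la lc ac la' lc' ac'; have fB := finite_between c' la'.
rewrite /fiber -/(fiber g a c) inner_fsuml// mulr_fsumr.
apply: eq_fsbigr => b /set_mem hb.
by rewrite innerZl inner_fiber ?triples_midP//; ring.
Qed.

Lemma sum_between_sqr a c : lev (-1) a -> lev 1 c -> (a < c)%O ->
  \sum_(b \in between P a c) (w a b * w a b) = 2 /\
  \sum_(b \in between P a c) (w b c * w b c) = 2.
Proof.
move=> la lc ac; have [b [b' [bb' e h]]] := between_pair la lc ac.
have hb : between P a c b by rewrite e; left.
have hb' : between P a c b' by rewrite e; right.
have [h1 h2] := wgt_sqr01 la lc hb; have [h3 h4] := wgt_sqr01 la lc hb'.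
by rewrite e !fsum_pair// -!intrM h1 h2 h3 h4.
Qed.

Lemma sum_between_alt a c : lev (-1) a -> lev 1 c -> (a < c)%O ->
  \sum_(b \in between P a c) (w a b * w b c) = 0.
Proof.
move=> la lc ac; have [b [b' [bb' e h]]] := between_pair la lc ac.
by rewrite e !fsum_pair// -!intrM h rmorphN/= addNr.
Qed.

(** Vectors of distinct (a, c) have disjoint supports and square norm 2, so [T0] is
the square root of 2 times an isometry. This bounds it independently of the
cardinals of the S_(>a). *)
Lemma exists_T0 : exists2 T0 : Em -> E0, bounded_map T0 &
  forall a c, lev (-1) a -> lev 1 c -> (a < c)%O ->
    T0 (zm (a, a, c)) = fiber (fun b => w a b) a c.
Proof.
have [||L bL hL] := @isometric_extension _ _ Em E0 (triples P (-1)) zm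
    (fun t => fiber (fun b => w t.1.1 b) t.1.1 t.2) 2 _ hzm.2.
- by [].
- move=> [[a x] c] [[a' x'] c'] tr tr'; rewrite hzm.1//=.
  have [-> la lc ac] := triples_bot tr; have [-> la' lc' ac'] := triples_bot tr'.
  rewrite inner_fiber2// !xpair_eqE mulrC.
  have [->/=|//] := eqVneq a a'; last by rewrite !mulr0.
  have [->/=|//] := eqVneq c c'; last by rewrite !mulr0.
  by rewrite (sum_between_sqr la' lc' ac').1.
by exists L => // a c la lc ac; rewrite hL//; exact: triples_botP.
Qed.

(** [U] is the adjoint of the second coboundary, and the same remark applies. *)
Lemma exists_U : exists2 U : E1 -> E0, bounded_map U &
  forall a c, lev (-1) a -> lev 1 c -> (a < c)%O ->
    U (z1 (a, c, c)) = fiber (fun b => w b c) a c.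
Proof.
have [||L bL hL] := @isometric_extension _ _ E1 E0 (triples P 1) z1
    (fun t => fiber (fun b => w b t.2) t.1.1 t.2) 2 _ hz1.2.
- by [].
- move=> [[a x] c] [[a' x'] c'] tr tr'; rewrite hz1.1//=.
  have [-> la lc ac] := triples_top tr; have [-> la' lc' ac'] := triples_top tr'.
  rewrite inner_fiber2// !xpair_eqE mulrC.
  have [->/=|//] := eqVneq a a'; last by rewrite !mulr0.
  have [->/=|//] := eqVneq c c'; last by rewrite !mulr0.
  by rewrite (sum_between_sqr la' lc' ac').2.
by exists L => // a c la lc ac; rewrite hL//; exact: triples_topP.
Qed.

Variables (T0 : Em -> E0) (T1 : E0 -> E1).

(** [T0] and [T1] extend the two coboundaries beyond A^(-1) and A^0; the second one
is specified through its adjoint. *)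
Definition coboundaries :=
  [/\ bounded_map T0, bounded_map T1,
      forall a c, lev (-1) a -> lev 1 c -> (a < c)%O ->
        T0 (zm (a, a, c)) = fiber (fun b => w a b) a c
    & forall a c x, lev (-1) a -> lev 1 c -> (a < c)%O ->
        inner (T1 x) (z1 (a, c, c)) = inner x (fiber (fun b => w b c) a c)].

Hypothesis hT : coboundaries.
Let bT0 : bounded_map T0. Proof. by case: hT. Qed.
Let bT1 : bounded_map T1. Proof. by case: hT. Qed.
Let T0E : forall a c, lev (-1) a -> lev 1 c -> (a < c)%O ->
        T0 (zm (a, a, c)) = fiber (fun b => w a b) a c.
Proof. by case: hT. Qed.
Let T1E : forall a c x, lev (-1) a -> lev 1 c -> (a < c)%O ->
        inner (T1 x) (z1 (a, c, c)) = inner x (fiber (fun b => w b c) a c).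
Proof. by case: hT. Qed.

Lemma T1_z0 a b c : lev (-1) a -> lev 1 c -> between P a c b ->
  T1 (z0 (a, b, c)) = w b c *: z1 (a, c, c).
Proof.
move=> la lc hb; have ac : (a < c)%O by case: hb => _ [+ +]; exact: lt_trans.
apply: (basis_ext hz1) => -[[a' x'] c'] tr.
have [ex la' lc' ac'] := triples_top tr; rewrite ex in tr *.
rewrite innerC T1E// inner_fiber ?triples_midP// innerZr hz1.1//; last first.
  exact: triples_topP.
rewrite !xpair_eqE [a == a']eq_sym [c == c']eq_sym.
have [ea|] := eqVneq a' a; last by rewrite mul0r mulr0.
have [->|] := eqVneq c' c; last by rewrite mul0r mulr0.
by rewrite mul1r mulr1.
Qed.

(** The only coordinate of [T1 (T0 z_aac)] that could be nonzero is
sum_(a < b < c) w_ab w_bc at (a, c, c), whose two terms cancel by (P5). *)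
Lemma T1T0 x : T1 (T0 x) = 0.
Proof.
apply: (basis_ext hz1) => -[[a x'] c] tr.
have [-> la lc ac] := triples_top tr; rewrite inner0r innerC T1E//.
have zx : closed_span (zm @` triples P (-1)) x by rewrite hzm.2.
apply: (bmap_orth_span bT0 _ zx) => _ [[[a' y] c'] tr' <-].
have [-> la' lc' ac'] := triples_bot tr'; rewrite T0E// inner_fiber2//.
have [ea|] := eqVneq a' a; last by rewrite mul0r.
have [ec|] := eqVneq c' c; last by rewrite mul0r.
by rewrite mul1r ea ec sum_between_alt.
Qed.

Local Notation zaa a := (zpair P zm a a).

Lemma finite_cover i a x : lev (-1) a -> (a <= x)%O ->
  finite_set [set y | lev i y /\ (x < y)%O].
Proof.
move=> la ax; apply: sub_finite_set (finite_above la) => y [_ xy] /=.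
exact: le_lt_trans xy.
Qed.

(** Both sides have the coordinate w_ab at every triple (a, b, c). *)
Lemma T0_zpair a : lev (-1) a ->
  T0 (zaa a) = \sum_(y \in [set y | lev 0 y /\ (a < y)%O]) w a y *: zpair P z0 a y.
Proof.
move=> la; have fA : finite_set (above P 1 a) by exact: (@finite_above_lev _ _ P 1 a).
have fB := finite_cover 0 la (lexx a).
apply: (basis_ext hz0) => -[[a' b'] c'] tr; case: (tr) => la' lb' lc' ab' bc'.
rewrite /zpair (bmap_fsum _ bT0)// !inner_fsumr//.
under eq_fsbigr => c /set_mem[lc ac].
  rewrite T0E ?inner_fiber ?(lt_flag la lc)//; over.
under [RHS]eq_fsbigr => b /set_mem[lb ab].
  rewrite innerZr -/(zpair _ _ _ _) (inner_zpair hz0)//; last exact: ltW. over.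
have [ea|aa] := eqVneq a' a; last first.
  rewrite !fsbig1// => x _; first by rewrite mulr0.
  by rewrite mul0r.
have ab2 : (a < b')%O by rewrite -ea (lt_flag la' lb').
rewrite (@fsum_single _ _ _ c')/=; last 2 first.
- by split=> //; rewrite -ea (le_trans ab').
- by move=> c _ cc; rewrite eq_sym (negbTE cc) mul0r.
rewrite (@fsum_single _ _ _ b')/=; last 2 first.
- by [].
- by move=> c _ cc; rewrite eq_sym (negbTE cc) mulr0.
by rewrite !eqxx mul1r mulr1.
Qed.

Lemma zpair_top a c : lev (-1) a -> lev 1 c -> (a <= c)%O ->
  zpair P z1 a c = z1 (a, c, c).
Proof.
move=> la lc ac; rewrite /zpair (fsum_single (j := c))//= => c' [lc' cc'] ne.
by rewrite (same_level_eq la ac cc' lc lc') eqxx in ne.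
Qed.

Lemma T1_zpair_above a b : lev (-1) a -> lev 0 b -> (a <= b)%O ->
  T1 (zpair P z0 a b) = \sum_(c \in above P 1 b) w b c *: z1 (a, c, c).
Proof.
move=> la lb ab; have fA := @finite_above_lev _ _ P 1 a b la ab isT.
rewrite /zpair (bmap_fsum _ bT1)//; apply: eq_fsbigr => c /set_mem[lc bc].
by rewrite T1_z0//; apply/triples_midP.
Qed.

Lemma above_mid b : lev 0 b -> above P 1 b = [set y | lev 1 y /\ (b < y)%O].
Proof.
move=> lb; apply/seteqP; split=> y [ly by_]; split=> //; last exact: ltW.
rewrite lt_neqAle by_ andbT; apply/eqP => h.
by move: ly; rewrite -h /level/= lb.
Qed.

Lemma T1_zpair a b : lev (-1) a -> lev 0 b -> (a <= b)%O ->
  T1 (zpair P z0 a b) =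
  \sum_(y \in [set y | lev 1 y /\ (b < y)%O]) w b y *: zpair P z1 a y.
Proof.
move=> la lb ab; rewrite T1_zpair_above// -above_mid//.
by apply: eq_fsbigr => c /set_mem[lc bc]; rewrite zpair_top// (le_trans ab).
Qed.

Lemma below_bot a : lev (-1) a -> below P a = [set a].
Proof.
move=> la; apply/seteqP; split=> [x [lx xa]|x ->]; last by split.
exact: (same_level_eq lx (lexx _) xa lx la).
Qed.

Lemma zpoint_bot a : lev (-1) a -> zpoint P zm a = zaa a.
Proof. by move=> la; rewrite /zpoint -/(below P a) below_bot// fsbig_set1. Qed.

Lemma spB_bot : spB P (-1) zm = spA P (-1) zm.
Proof.
congr closed_span; apply/seteqP; split=> [_ [a la <-]|_ [[a x] [/= la lx ax] <-]].
  by exists (a, a); rewrite ?zpoint_bot.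
by exists a; rewrite ?zpoint_bot// (same_level_eq la (lexx a) ax la lx).
Qed.

Lemma spA_top : spA P 1 z1 = setT.
Proof.
apply/seteqP; split=> // x _; have : closed_span (z1 @` triples P 1) x.
  by rewrite hz1.2.
apply: closed_span_sub; first exact: closed_spanP.
move=> _ [[[a y] c] tr <-]; have [-> la lc ac] := triples_top tr.
by rewrite -zpair_top ?ltW//; apply: zpair_spA => //; exact: ltW.
Qed.

Lemma T0_spA x : spA P (-1) zm x -> spA P 0 z0 (T0 x).
Proof.
have := csub_preimage bT0 (closed_spanP [set zpair P z0 t.1 t.2 | t in flags P 0]).
move=> /closed_span_sub; apply => _ [[a y] [/= la ly ay] <-].
rewrite -(same_level_eq la (lexx a) ay la ly) /= T0_zpair//.
apply: (csub_fsum (closed_spanP _)).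
move=> b [lb ab]; apply: (csubZ _ (closed_spanP _)).
by apply: zpair_spA => //; exact: ltW.
Qed.

Local Notation A := (complexA P zm z0 z1).
Local Notation B := (complexB P zm z0 z1).

(** * The complex A *)

Lemma cobd0_spec :
  bounded_linear_on (spA P (-1) zm) (spA P 0 z0) (map0 A) /\
  cobd_formula P 0 zm z0 (map0 A).
Proof.
apply: (@xgetPex _ (fun=> 0) [set f |
  bounded_linear_on (spA P (0 - 1) zm) (spA P 0 z0) f /\
  cobd_formula P 0 zm z0 f]).
exists T0; split.
  apply: blin_of_bounded_map => // x; rewrite sub0r; exact: T0_spA.
move=> a x la; rewrite sub0r => lx ax.
rewrite -(same_level_eq la (lexx a) ax la lx).
exact: (T0_zpair la).
Qed.

Lemma cobd1_spec :
  bounded_linear_on (spA P 0 z0) (spA P 1 z1) (map1 A) /\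
  cobd_formula P 1 z0 z1 (map1 A).
Proof.
apply: (@xgetPex _ (fun=> 0) [set f |
  bounded_linear_on (spA P (1 - 1) z0) (spA P 1 z1) f /\
  cobd_formula P 1 z0 z1 f]).
exists T1; split.
  by apply: blin_of_bounded_map => // x _; rewrite spA_top.
move=> a x la; rewrite subrr => lx ax.
exact: T1_zpair.
Qed.

Lemma map0AE x : spA P (-1) zm x -> map0 A x = T0 x.
Proof.
have [b0 f0] := cobd0_spec; apply: (blin_eq_span bT0 b0).
move=> _ [[a y] [/= la ly ay] <-].
have e := same_level_eq la (lexx a) ay la ly; rewrite -e (T0_zpair la).
by apply: f0 => //; rewrite sub0r.
Qed.

Lemma map1AE x : spA P 0 z0 x -> map1 A x = T1 x.
Proof.
have [b1 f1] := cobd1_spec; apply: (blin_eq_span bT1 b1).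
move=> _ [[a y] [/= la ly ay] <-]; rewrite T1_zpair//.
by apply: f1 => //; rewrite subrr.
Qed.

Lemma complexA_is_complex : is_complex3 A.
Proof.
split; [by split; exact: closed_spanP|exact: cobd0_spec.1|exact: cobd1_spec.1|].
move=> x Ax; rewrite map0AE// map1AE ?T1T0//.
exact: T0_spA.
Qed.

Lemma spA0_coord x a b c c' : spA P 0 z0 x -> triples P 0 (a, b, c) ->
  triples P 0 (a, b, c') -> inner x (z0 (a, b, c)) = inner x (z0 (a, b, c')).
Proof.
move=> Ax tr tr'; apply/eqP; rewrite -subr_eq0 -innerBr; apply/eqP.
apply: (orth_closed_span _ Ax) => _ [[a' b'] [/= la lb ab] <-].
by rewrite innerBr !(innerC (zpair _ _ _ _)) !(inner_zpair hz0)// subrr.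
Qed.

(** Let x_ab be the coordinate of [x] at (a, b, c), which does not depend on c. As
[T1 x] vanishes, (P5) makes w_ab x_ab take the same value at the two b below each
c, so by connectedness of S_(>a) it is a constant k on S_(>a). Then the inner product
of [x] with [T0] z_aa is k times a positive number. *)
Lemma harmonicA_eq0 x : spA P 0 z0 x -> T1 x = 0 ->
  (forall a, lev (-1) a -> inner (T0 (zaa a)) x = 0) -> x = 0.
Proof.
move=> Ax T1x T0x; apply: (basis_ext hz0) => -[[a b0] c0] tr0.
rewrite inner0r; case: (tr0) => la lb0 lc0 ab0 bc0.
pose co b c := w a b * inner x (z0 (a, b, c)).
have co_pair c b b' : lev 1 c -> between P a c b -> between P a c b' ->
    co b c = co b' c.
  move=> lc hb hb'; have ac : (a < c)%O by case: hb => _ [+ +]; exact: lt_trans.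
  have [b1 [b2 [b12 eB hw]]] := between_pair la lc ac.
  suff : co b1 c = co b2 c.
    by move: hb hb'; rewrite eB => -[->|->] [->|->].
  have hb1 : between P a c b1 by rewrite eB; left.
  have hb2 : between P a c b2 by rewrite eB; right.
  have [s1 s2] := wgt_sqr01 la lc hb1; have [s3 s4] := wgt_sqr01 la lc hb2.
  have : inner (T1 x) (z1 (a, c, c)) = 0 by rewrite T1x inner0l.
  rewrite T1E// /fiber inner_fsumr; last exact: finite_between.
  rewrite eB fsum_pair// !innerZr /co => e.
  have s4' : w b2 c * w b2 c = 1 by rewrite -intrM s4.
  have s2' : w b1 c * w b1 c = 1 by rewrite -intrM s2.
  have hw' : w a b1 * w b1 c = - (w a b2 * w b2 c) by rewrite -!intrM hw rmorphN.
  move: e s2' s4' hw'; set i1 := inner x _; set i2 := inner x _.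
  set p := w a b1; set q := w a b2; set r := w b1 c; set s := w b2 c => e s2' s4' hw'.
  have h1 : p * i1 = p * r * (r * i1).
    by rewrite -mulrA [r * (r * _)]mulrA s2' mul1r.
  have h2 : q * i2 = q * s * (s * i2).
    by rewrite -mulrA [s * (s * _)]mulrA s4' mul1r.
  have h3 : r * i1 = - (s * i2) by apply/eqP; rewrite -addr_eq0 e.
  by rewrite h1 h2 hw' h3 mulrNN.
pose k := co b0 c0.
(* the value k at the pairs b < c that involve u, for u of level 0 or 1; this
   property propagates along comparabilities in S_(>a) *)
pose good u := forall b c, lev 1 c -> between P a c b -> (u = b \/ u = c) ->
  co b c = k.
have ab0' := lt_flag la lb0 ab0 isT.
have co_mid b c c' : lev 1 c -> lev 1 c' -> between P a c b -> between P a c' b ->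
    co b c = co b c'.
  move=> lc lc' hb hb'.
  by rewrite /co (@spA0_coord x a b c c')//; exact/triples_midP.
have hb0 : between P a c0 b0 by apply/triples_midP.
have good_b0 : good b0.
  move=> b c lc hb [e|e]; last by move: lc; rewrite -e /level/= lb0.
  by rewrite -e in hb *; exact: co_mid.
have step u v : (a < u)%O -> (a < v)%O -> (u >=< v)%O -> good u -> good v.
  move=> au av uv gu b c lc hb e.
  have [uEv|uv'] := eqVneq u v; first by apply: gu => //; rewrite uEv.
  have lt_rho y y' : (a < y)%O -> (y < y')%O -> rho P y < rho P y'.
    by move=> ay; exact: (rho_lt_above la (ltW ay)).
  have rho_gt y : (a < y)%O -> -1 < rho P y.
    by move=> ay; have := rho_lt_above la (lexx a) ay; rewrite la.
  have /orP[uv1|vu1] : (u < v)%O || (v < u)%O.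
    by move: uv; rewrite /Order.comparable !le_eqVlt [v == u]eq_sym (negbTE uv').
  - have := lt_rho _ _ au uv1; have := rho_gt _ au; case: hb => lb [ab bc].
    case: e => e; first by rewrite e lb => h1 h2; exfalso; lia.
    rewrite e lc => h1 h2; rewrite e in uv1; have lu : lev 0 u.
      by case: (rho_cases P u) => // lu; exfalso; move: h1 h2; rewrite lu; lia.
    by rewrite (@co_pair c b u)//; apply: gu => //; left.
  - have := lt_rho _ _ av vu1; case: (hb) => lb [ab bc].
    case: e => e; last first.
      rewrite e lc; have /andP[_ +] := rho_range P u.
      by move=> h1 h2; exfalso; lia.
    rewrite e lb => h2; rewrite e in vu1; have lu : lev 1 u.
      by case: (rho_cases P u) => // lu; exfalso; move: h2; rewrite lu; lia.
    by rewrite (@co_mid b c u)//; apply: gu => //; right.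
have good_all u : (a < u)%O -> good u.
  move=> au; have [_ conn] := garlandP4 la.
  have [p [pth lst pin]] := conn b0 u ab0' au.
  elim: p (b0) good_b0 ab0' pth lst pin => [|v p ih] y gy ay /=.
    by move=> _ <- _.
  move=> /andP[yv pth] lst pin.
  have av : (a < v)%O by apply: pin; rewrite inE eqxx.
  apply: (ih v) => //; first exact: step yv gy.
  by move=> t tp; apply: pin; rewrite inE tp orbT.
have co_k b c : lev 1 c -> between P a c b -> co b c = k.
  by move=> lc hb; apply: (good_all b) => //; [case: hb => _ []|left].
have ac0 : (a < c0)%O by case: hb0 => _ [+ +]; exact: lt_trans.
have fA := @finite_above_lev _ _ P 1 a a la (lexx a) isT.
have : inner (T0 (zaa a)) x = num_above P a * (2 * k).
  rewrite /zpair (bmap_fsum _ bT0)// inner_fsuml// /num_above mulr_fsuml.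
  apply: eq_fsbigr => c /set_mem[lc ac]; have {}ac := lt_flag la lc ac isT.
  rewrite T0E// /fiber inner_fsuml; last exact: finite_between.
  have [b1 [b2 [b12 eB _]]] := between_pair la lc ac.
  rewrite (eq_fsbigr (fun=> k)); first by rewrite eB fsum_pair//; ring.
  by move=> b /set_mem hb; rewrite innerZl -(co_k b c)// /co innerC.
rewrite T0x// => /esym/eqP; rewrite mulf_eq0 gt_eqF/=; last first.
  by apply: (@num_above_gt0 _ _ _ P a a c0) => //; split=> //; exact: ltW.
rewrite mulf_eq0 pnatr_eq0/= => /eqP; rewrite /k /co => k0.
have [s1 _] := wgt_sqr01 la lc0 hb0.
rewrite -[LHS]mul1r [LHS]mulrC innerC.
have -> : 1 = w a b0 * w a b0 by rewrite -intrM s1.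
by rewrite mulrC -mulrA k0 mulr0.
Qed.

Lemma inner_T0_bot x : (forall a, lev (-1) a -> inner (T0 (zaa a)) x = 0) ->
  forall u, spA P (-1) zm u -> inner (T0 u) x = 0.
Proof.
move=> h u Au; apply: (bmap_orth_span bT0 _ Au) => _ [[a y] [/= la ly ay] <-].
by rewrite -(same_level_eq la (lexx a) ay la ly) h.
Qed.

Lemma zaa_spA a : lev (-1) a -> spA P (-1) zm (zaa a).
Proof. by move=> la; exact: zpair_spA. Qed.

Lemma H0_eq0_A : H0_eq0 A.
Proof.
apply: H0_eq0_of_harmonic; first exact: complexA_is_complex.
move=> x [Ax]; rewrite map1AE// => T1x h; apply: harmonicA_eq0 => // a la.
by rewrite -map0AE ?h//; exact: zaa_spA.
Qed.

(** * The complex B *)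

Local Notation zb b := (zpoint P z0 b).
Local Notation zc c := (zpoint P z1 c).
Local Notation N0 := ((n0 P)%:R : R).
Local Notation N010 := ((n010 P)%:R : R).
Local Notation kappa := ((N0 - N010) / N0).

Lemma below_mid b : lev 0 b -> below P b = [set x | (x < b)%O].
Proof.
move=> lb; apply/seteqP; split=> x /=; first by case=> lx xb; exact: (lt_flag lx lb).
by move=> xb; split; [exact: below_level lb xb|exact: ltW].
Qed.

Lemma card_below_mid b : lev 0 b -> below P b #= `I_(n0 P).
Proof. by move=> lb; rewrite below_mid//; exact: garlandP1. Qed.

Lemma n0_neq0 a b : lev 0 b -> below P b a -> N0 != 0.
Proof.
move=> lb ab; rewrite pnatr_eq0; apply/eqP => n00.
have := card_below_mid lb; rewrite n00 II0 card_eq0 => /eqP b0.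
by move: ab; rewrite b0.
Qed.

Lemma finite_above_mid a b : lev 0 b -> below P b a -> finite_set (above P 1 b).
Proof. by move=> lb [la ab]; exact: (@finite_above_lev _ _ P 1 a). Qed.

(** If n0 = 0, the set of elements above b may be infinite; then z_b = 0. *)
Lemma zpoint_eq0 b : ~ (exists a, below P b a) -> zb b = 0.
Proof. by move=> h; rewrite /zpoint fsbig1// => a ab; case: h; exists a. Qed.

Lemma inner_T1_zpoint_z1 a b c : lev 0 b -> lev (-1) a -> lev 1 c -> (a < c)%O ->
  inner (T1 (zb b)) (z1 (a, c, c)) = if b \in between P a c then w b c else 0.
Proof.
move=> lb la lc ac; case: hT => _ _ _ -> //.
rewrite /fiber inner_fsumr; last exact: finite_between.
case: ifPn => [/set_mem hb|hb].
  rewrite (fsum_single hb) ?innerZr 1?innerC ?(inner_zpoint hz0) ?eqxx ?mulr1//.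
    exact/triples_midP.
  move=> b' hb' bb'; rewrite innerZr innerC (inner_zpoint hz0)//.
    by rewrite (negbTE bb') mulr0.
  exact/triples_midP.
rewrite fsbig1// => b' hb'; rewrite innerZr innerC (inner_zpoint hz0)//.
  case: eqP => [e|]; last by rewrite mulr0.
  by move: hb; rewrite -e mem_set.
exact/triples_midP.
Qed.

Lemma T1_zpoint b v : lev 0 b -> inner (T1 (zb b)) v =
  \sum_(a \in below P b) \sum_(c \in above P 1 b) w b c * inner (z1 (a, c, c)) v.
Proof.
move=> lb; have fB := finite_below_lev lb.
rewrite /zpoint (bmap_fsum _ bT1)// inner_fsuml//.
apply: eq_fsbigr => a /set_mem hab; case: (hab) => la ab.
rewrite T1_zpair_above// inner_fsuml; last exact: finite_above_mid hab.
by apply: eq_fsbigr => c _; rewrite innerZl.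
Qed.

Lemma inner_T1_zpoint b c : lev 0 b -> lev 1 c ->
  inner (T1 (zb b)) (zc c) = N0 * (if c \in above P 1 b then w b c else 0).
Proof.
move=> lb lc; rewrite T1_zpoint//.
rewrite (eq_fsbigr (fun=> if c \in above P 1 b then w b c else 0)).
  by rewrite (fsum_const _ (card_below_mid lb)).
move=> a /set_mem[la ab]; case: ifPn => [/set_mem hc|hc].
  rewrite (fsum_single hc).
    rewrite (inner_zpoint hz1) ?eqxx ?mulr1//.
    by case: hc => _ bc; split=> //; exact: le_trans bc.
  move=> c' [lc' bc'] cc'; rewrite (inner_zpoint hz1)// ?(negbTE cc') ?mulr0//.
  by split=> //; exact: le_trans bc'.
rewrite fsbig1// => c' hc'; case: (hc') => lc' bc'; rewrite (inner_zpoint hz1)//.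
  case: eqP => [e|]; last by rewrite mulr0.
  by move: hc; rewrite -e mem_set.
by split=> //; exact: le_trans bc'.
Qed.

Let W b b' := \sum_(c \in above P 1 b `&` above P 1 b') (w b c * w b' c).

Let WE b b' : W b b' =
  \sum_(c \in above P 1 b) if c \in above P 1 b' then w b c * w b' c else 0.
Proof. exact: fsbig_mkcondr. Qed.

Let WC b b' : W b b' = W b' b.
Proof. by rewrite /W setIC; apply: eq_fsbigr => c _; rewrite mulrC. Qed.

(** In the sum over a below b and c above b, the nonzero terms are those with a below
b' and c above b' as well. *)
Lemma inner_T1_zpoint2 b b' n : lev 0 b -> lev 0 b' ->
  below P b `&` below P b' #= `I_n ->
  inner (T1 (zb b)) (T1 (zb b')) = n%:R * W b b'.
Proof.
move=> lb lb' hn; rewrite T1_zpoint//.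
rewrite (eq_fsbigr (fun a => if a \in below P b' then W b b' else 0)).
  by rewrite -fsbig_mkcondr (fsum_const _ hn).
move=> a /set_mem[la ab].
case: ifPn => hab'.
  rewrite WE; apply: eq_fsbigr => c /set_mem[lc bc].
  have ac : (a < c)%O by rewrite (lt_flag la lc)// (le_trans ab).
  rewrite innerC inner_T1_zpoint_z1//; have [_ ab'] := set_mem hab'.
  have -> : (b' \in between P a c) = (c \in above P 1 b').
    apply/idP/idP => /set_mem h; apply/mem_set; first by case: h => _ [_ /ltW].
    by case: h => _ bc'; apply/triples_midP.
  by case: ifP; rewrite ?mulr0.
apply: fsbig1 => c [lc bc].
have ac : (a < c)%O by rewrite (lt_flag la lc)// (le_trans ab).
rewrite innerC inner_T1_zpoint_z1//; case: ifPn; last by rewrite mulr0.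
move=> /set_mem[_ [ab' _]]; move: hab'; rewrite mem_set//; split=> //; exact: ltW.
Qed.

Lemma W_diag a b : lev 0 b -> below P b a -> W b b = num_above P b.
Proof.
move=> lb [la ab]; rewrite /W setIid /num_above; apply: eq_fsbigr => c /set_mem[lc bc].
have [|_ s] := @wgt_sqr01 _ _ P a b c la lc; first by apply/triples_midP.
by rewrite -intrM s.
Qed.

(** For all [x] in B^0 and b of level 0,
<T1 x, T1 z_b> = kappa <x, z_b> + n010/n0 * sum_(c > b) w_bc <T1 x, z_c>,
which is linear in [x] and is checked on [x] = z_b': by [inner_T1_zpoint2] the left
hand side counts the common lower bounds of b and b', of which there are n0 or n010
according as b = b' or not. The hypothesis on [x] removes the last term. *)
Lemma inner_T1_ker1 x y : spB P 0 z0 x -> spB P 0 z0 y ->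
  (forall c, lev 1 c -> inner (T1 x) (zc c) = 0) ->
  inner (T1 x) (T1 y) = kappa * inner x y.
Proof.
move=> Bx By hx; rewrite innerC [inner x y]innerC.
have := csub_inner_eq x (T1 x) kappa bT1.
move=> cX; apply: (closed_span_sub cX _ By) => _ [b' lb' <-] /=.
rewrite innerC [inner _ x]innerC.
have [[a' hb']|nb'] := pselect (exists a, below P b' a); last first.
  by rewrite zpoint_eq0// (bmap0 bT1) !inner0r mulr0.
have fA := finite_above_mid lb' hb'; have N00 := n0_neq0 lb' hb'.
pose v := \sum_(c \in above P 1 b') w b' c *: zc c.
have hv : inner (T1 x) v = 0.
  rewrite inner_fsumr// fsbig1// => c [lc _]; by rewrite innerZr hx// mulr0.
suff : inner (T1 x) (T1 (zb b') - (N010 / N0) *: v) = kappa * inner x (zb b').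
  by rewrite innerBr innerZr hv mulr0 subr0.
have := csub_inner_eq (zb b') (T1 (zb b') - (N010 / N0) *: v) kappa bT1.
move=> cX'; apply: (closed_span_sub cX' _ Bx) => _ [b lb <-] /=.
have [[a hb]|nb] := pselect (exists a, below P b a); last first.
  by rewrite zpoint_eq0// (bmap0 bT1) !inner0l mulr0.
have bv : inner (T1 (zb b)) v = N0 * W b b'.
  rewrite inner_fsumr// WC WE mulr_fsumr.
  apply: eq_fsbigr => c /set_mem[lc bc]; rewrite innerZr inner_T1_zpoint//.
  by case: ifP => _; ring.
rewrite innerBr innerZr bv (inner_zpoint_zpoint hz0 lb lb' (card_below_mid lb)).
have [e|bb'] := eqVneq b b'.
  rewrite -e (@inner_T1_zpoint2 b b (n0 P))//; last first.
    by rewrite setIid; exact: card_below_mid.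
  by rewrite (W_diag lb hb) mul1r; field.
rewrite mul0r mulr0.
have [[c [hc hc']]|nc] := pselect (exists c, (above P 1 b `&` above P 1 b') c); last first.
  have W0 : W b b' = 0 by rewrite /W fsbig1// => c hc; case: nc; exists c.
  rewrite W0 !mulr0 subr0.
  have := sub_finite_set (@subIsetl _ _ (below P b')) (finite_below_lev lb).
  by move=> [n hn]; rewrite (inner_T1_zpoint2 lb lb' hn) W0 mulr0.
rewrite (@inner_T1_zpoint2 b b' (n010 P))//; first by field.
have lt_c u : lev 0 u -> above P 1 u c -> (u < c)%O.
  by move=> lu; rewrite above_mid// => -[].
have := garlandP3 lb lb' hc.1 (elimN eqP bb') (lt_c b lb hc) (lt_c b' lb' hc').
by rewrite !below_mid.
Qed.

(** Projecting to B^0 replaces z_ab by z_b / n0: both have the same inner products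
with all z_b'. *)
Lemma proj_T0 a : lev (-1) a -> orth_proj (spB P 0 z0) (T0 (zaa a)) =
  \sum_(b \in [set y | lev 0 y /\ (a < y)%O]) (w a b / N0) *: zb b.
Proof.
move=> la; have fA := finite_cover 0 la (lexx a).
apply: orth_proj_uniq.
- exact: closed_spanP.
- apply: (csub_fsum (closed_spanP _)) => b [lb _].
  by apply: (csubZ _ (closed_spanP _)); exact: zpoint_spB.
move=> u Bu; apply/eqP; rewrite -subr_eq0 -innerBl innerC; apply/eqP.
apply: (orth_closed_span _ Bu) => _ [b' lb' <-].
rewrite innerBr (T0_zpair la) !inner_fsumr//.
apply/eqP; rewrite subr_eq0; apply/eqP.
apply: eq_fsbigr => b /set_mem[lb ab]; rewrite !innerZr.
have hab : below P b a by split=> //; exact: ltW.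
rewrite (inner_zpoint_zpoint hz0 lb' lb (card_below_mid lb')).
rewrite [in RHS]innerC (inner_zpair_zpoint hz0 la lb (ltW ab) lb') eq_sym.
by have [<-|_] := eqVneq b' b; rewrite ?mul0r ?mulr0// !mul1r; field; exact: n0_neq0 hab.
Qed.

(** By [proj_T0], the inner product with z_c is a sum over the b between a and c, which
vanishes by the sign rule. *)
Lemma proj_T1_proj_T0 x : spA P (-1) zm x ->
  orth_proj (spB P 1 z1) (T1 (orth_proj (spB P 0 z0) (T0 x))) = 0.
Proof.
have c0 := closed_spanP (zpoint P z0 @` lev 0).
have c1 := closed_spanP (zpoint P z1 @` lev 1).
have := csub_vanish (bounded_comp (orth_proj_bounded c1)
  (bounded_comp bT1 (bounded_comp (orth_proj_bounded c0) bT0))).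
move=> /closed_span_sub; apply=> _ [[a y] [/= la ly ay] <-] /=.
rewrite -(same_level_eq la (lexx a) ay la ly) proj_T0//.
have fA := finite_cover 0 la (lexx a).
apply/orth_proj_eq0 => // u Bu; rewrite innerC.
apply: (orth_closed_span _ Bu) => _ [c lc <-].
rewrite innerC (bmap_fsum _ bT1)// inner_fsuml//.
transitivity (\sum_(b \in [set y | lev 0 y /\ (a < y)%O])
    if b \in [set b | (b < c)%O] then w a b * w b c else 0).
  apply: eq_fsbigr => b /set_mem[lb ab].
  have hab : below P b a by split=> //; exact: ltW.
  rewrite (bmapZ _ _ bT1) innerZl inner_T1_zpoint//.
  rewrite (_ : (c \in above P 1 b) = (b \in [set b | (b < c)%O])).
    by case: ifP => _; field; exact: n0_neq0 hab.
  rewrite above_mid//.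
  by apply/idP/idP => /set_mem h; apply/mem_set; [case: h|split].
rewrite -fsbig_mkcondr.
have [ac|nac] := boolP (a < c)%O.
  rewrite -[RHS](sum_between_alt la lc ac).
  apply: eq_fsbigl; apply/seteqP; split=> b; first by move=> [[? ?] ?].
  by move=> [? [? ?]].
apply: fsbig1 => b [[_ ab] bc]; by rewrite (lt_trans ab bc) in nac.
Qed.

Local Notation Aat a := (complexAat P zm z0 z1 a).

(** * The Garland structure *)

Let m0E x : spA P (-1) zm x -> map0 A x = T0 x.
Proof. exact: map0AE. Qed.

Let m1E x : spA P 0 z0 x -> map1 A x = T1 x.
Proof. exact: map1AE. Qed.

Let cobd0E x : spA P (-1) zm x -> cobd P 0 zm z0 x = T0 x.
Proof. exact: m0E. Qed.

Let cobd1E x : spA P 0 z0 x -> cobd P 1 z0 z1 x = T1 x.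
Proof. exact: m1E. Qed.

Lemma complexB_is_complex : is_complex3 B.
Proof.
have [_ bA0 bA1 _] := complexA_is_complex.
have cB0 : closed_subspace (spB P 0 z0) := closed_spanP _.
have cB1 : closed_subspace (spB P 1 z1) := closed_spanP _.
split.
- by split => //; exact: closed_spanP.
- have : bounded_linear_on (spB P (-1) zm) (spB P 0 z0) (orth_proj (spB P 0 z0) \o T0).
    apply: blin_of_bounded_map => [|x _]; last exact: orth_proj_in.
    exact: bounded_comp (orth_proj_bounded cB0) bT0.
  rewrite spB_bot => -[h1 h2 h3].
  split=> /=; rewrite spB_bot.
  + by move=> x Ax; rewrite cobd0E//; exact: h1.
  + move=> k x y Ax Ay; rewrite !cobd0E//; first exact: h2.
    by case: (closed_spanP [set zpair P zm t.1 t.2 | t in flags P (-1)]) => _ _; apply.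
  + by case: h3 => M hM; exists M => x Ax; rewrite cobd0E//; exact: hM.
- have : bounded_linear_on (spB P 0 z0) (spB P 1 z1) (orth_proj (spB P 1 z1) \o T1).
    apply: blin_of_bounded_map => [|x _]; last exact: orth_proj_in.
    exact: bounded_comp (orth_proj_bounded cB1) bT1.
  have BA := @spB_sub_spA _ _ _ P _ 0 z0.
  move=> [h1 h2 h3]; split=> /=.
  + by move=> x Bx; rewrite cobd1E; [exact: h1|exact: BA].
  + move=> k x y Bx By; rewrite !cobd1E; [exact: h2|exact: BA|exact: BA|].
    by apply: BA; case: cB0 => _ _; apply.
  + by case: h3 => M hM; exists M => x Bx; rewrite cobd1E; [exact: hM|exact: BA].
- rewrite /= spB_bot => x Ax; rewrite cobd0E// cobd1E.
    exact: proj_T1_proj_T0.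
  by apply: spB_sub_spA; exact: orth_proj_in.
Qed.

Lemma garland_structureAB : garland_structure A B.
Proof.
split.
- by split; [exact: complexA_is_complex|exact: complexB_is_complex].
- exact: H0_eq0_A.
- by split=> /=; [exact: spB_bot|exact: spB_sub_spA|exact: spB_sub_spA].
- by [].
- by [].
Qed.

(** The space A_a^0, made zero when a is not of level -1 so that the family is
orthogonal over all of S. *)
Definition blockA a : set E0 :=
  closed_span (zpair P z0 a @` [set x | [/\ lev (-1) a, lev 0 x & (a <= x)%O]]).

Lemma blockAE a : lev (-1) a -> blockA a = spAat P 0 z0 a.
Proof.
move=> la; congr (closed_span (_ @` _)); apply/seteqP.
by split=> x /=; [case|case].
Qed.

Lemma blockA_csub a : closed_subspace (blockA a).
Proof. exact: closed_spanP. Qed.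

Lemma blockA_orth a a' x y : a != a' -> blockA a x -> blockA a' y -> inner x y = 0.
Proof.
move=> aa; apply: (span_orth2 (bounded_id E0)) =>
  _ _ [b [la lb ab] <-] [b' [la' lb' ab'] <-].
rewrite /= (inner_zpair_sum _ _ la lb ab) fsbig1// => c [lc bc].
by rewrite (inner_zpair hz0)// (negbTE aa).
Qed.

Lemma blockA_orth_T1 a a' x y : a != a' -> blockA a x -> blockA a' y ->
  inner (T1 x) (T1 y) = 0.
Proof.
move=> aa; apply: (span_orth2 bT1) => _ _ [b [la lb ab] <-] [b' [la' lb' ab'] <-].
rewrite T1_zpair_above// inner_fsuml; last first.
  exact: (@finite_above_lev _ _ P 1 a).
apply: fsbig1 => c [lc bc]; rewrite innerZl T1_zpair_above//.
rewrite inner_fsumr; last exact: (@finite_above_lev _ _ P 1 a').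
rewrite fsbig1 ?mulr0// => c' [lc' bc']; rewrite innerZr hz1.1.
- by rewrite !xpair_eqE (negbTE aa) mulr0.
- by split=> //; exact: le_trans bc.
- by split=> //; exact: le_trans bc'.
Qed.

Lemma spA_blocks : spA P 0 z0 `<=` closed_span (\bigcup_a blockA a).
Proof.
apply: closed_span_sub; first exact: closed_spanP.
move=> _ [[a x] [/= la lx ax] <-]; apply: sub_closed_span.
by exists a => //; apply: sub_closed_span; exists x.
Qed.

Lemma blockA_spA a : blockA a `<=` spA P 0 z0.
Proof.
apply: closed_span_sub; first exact: closed_spanP.
by move=> _ [x [la lx ax] <-]; exact: zpair_spA.
Qed.

Lemma T0_block a : lev (-1) a -> blockA a (T0 (zaa a)).
Proof.
move=> la; rewrite (T0_zpair la); apply: (csub_fsum (blockA_csub a)).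
move=> b [lb ab]; apply: (csubZ _ (blockA_csub a)); apply: sub_closed_span.
by exists b => //; split=> //; exact: ltW.
Qed.

Lemma ker0adjAP x : ker0adj A x <->
  spA P 0 z0 x /\ forall a, lev (-1) a -> inner (T0 (zaa a)) x = 0.
Proof.
have [_ bA0 _ _] := complexA_is_complex.
have hadj := adjoint_on_eq0 (closed_spanP _) x bA0.
split=> [[Ax /hadj h]|[Ax h]]; split=> //.
  by move=> a la; rewrite -m0E ?h//; exact: zaa_spA.
by apply/hadj => u Au; rewrite m0E//; exact: (inner_T0_bot h).
Qed.

Lemma ker0adjAatP a x : lev (-1) a -> ker0adj (Aat a) x <->
  blockA a x /\ inner (T0 (zaa a)) x = 0.
Proof.
move=> la; have [_ bA0 _ _] := complexA_is_complex.
have sub : spAat P (-1) zm a `<=` spA P (-1) zm.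
  apply: closed_span_sub; first exact: closed_spanP.
  by move=> _ [y [ly ay] <-]; exact: zpair_spA.
have A0 y : spAat P (-1) zm a y -> sp0 A (map0 A y).
  by case: bA0 => h _ _ /sub; exact: h.
have bAa := blin_restrict sub A0 bA0.
have hadj := adjoint_on_eq0 (closed_spanP _) x bAa.
rewrite (blockAE la); split=> [[Ax /hadj h]|[Ax h]]; split=> //.
  rewrite -m0E; last exact: zaa_spA.
  by apply: h; apply: sub_closed_span; exists a.
apply/hadj => u Au; rewrite m0E; last exact: sub.
apply: (bmap_orth_span bT0 _ Au) => _ [y [ly ay] <-].
by rewrite -(same_level_eq la (lexx a) ay la ly) h.
Qed.

Lemma proj_block_ker x a : spA P 0 z0 x ->
  (forall a, lev (-1) a -> inner (T0 (zaa a)) x = 0) ->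
  lev (-1) a -> ker0adj (Aat a) (orth_proj (blockA a) x).
Proof.
move=> Ax hx la; apply/ker0adjAatP => //; split.
  exact: orth_proj_in (blockA_csub a) x.
rewrite innerC (orth_proj_inner (blockA_csub a)); last exact: T0_block.
by rewrite innerC hx.
Qed.

Lemma block_trivial a x : ~ lev (-1) a -> blockA a x -> x = 0.
Proof.
move=> na Bx; apply: inner_eq0.
by apply: (orth_closed_span _ Bx) => y [b [la]].
Qed.

Lemma alpha_block_le (r : R) a y : lev (-1) a -> ker0adj (Aat a) y ->
  (r%:E <= alpha (Aat a))%E -> r * `|y| ^+ 2 <= `|T1 y| ^+ 2.
Proof.
move=> la /ker0adjAatP[]// By hy hr.
have [->|y0] := eqVneq y 0; first by rewrite (bmap0 bT1) !normr0 expr0n mulr0.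
have ny : `|y| != 0 by rewrite normr_eq0.
pose u := `|y|^-1 *: y.
have Bu : blockA a u by exact: csubZ _ (blockA_csub a) By.
have nu : `|u| = 1 by rewrite normrZ normfV normr_id mulVf.
have : (alpha (Aat a) <= (`|map1 A u| ^+ 2)%:E)%E.
  apply: ereal_inf_lbound; exists u => //; split=> //.
  by apply/ker0adjAatP => //; split=> //; rewrite innerZr hy mulr0.
move=> /(le_trans hr); rewrite lee_fin m1E; last exact: blockA_spA Bu.
rewrite (bmapZ _ _ bT1) normrZ normfV normr_id exprMn exprVn mulrC.
by rewrite ler_pdivlMr// exprn_gt0// normr_gt0.
Qed.

(** Any real number strictly between [r] and the infimum yields strictness. *)
Lemma alpha_block_lt (r : R) a y : lev (-1) a -> ker0adj (Aat a) y ->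
  (r%:E < alpha (Aat a))%E -> y != 0 -> r * `|y| ^+ 2 < `|T1 y| ^+ 2.
Proof.
move=> la ky hr y0.
have [r' rr' hr'] : exists2 r', r < r' & (r'%:E <= alpha (Aat a))%E.
  move: hr; case: (alpha _) => [s| |] hr.
  - by exists s => //; rewrite -lte_fin.
  - by exists (r + 1); rewrite ?ltrDl ?leey.
  - by rewrite ltNge leNye in hr.
apply: lt_le_trans (alpha_block_le la ky hr').
by rewrite ltr_pM2r// exprn_gt0// normr_gt0.
Qed.

Let q (r : R) x := `|T1 x| ^+ 2 - r * `|x| ^+ 2.

Lemma block_q_ge0 (r : R) x : spA P 0 z0 x ->
  (forall a, lev (-1) a -> inner (T0 (zaa a)) x = 0) ->
  (forall a, lev (-1) a -> (r%:E <= alpha (Aat a))%E) ->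
  forall a, 0 <= q r (orth_proj (blockA a) x).
Proof.
move=> Ax hx hr a; have [la|na] := pselect (lev (-1) a).
  by rewrite subr_ge0 (alpha_block_le la _ (hr _ la))//; exact: proj_block_ker.
rewrite (block_trivial na (orth_proj_in (blockA_csub a) x)).
by rewrite /q (bmap0 bT1) !normr0 expr0n mulr0 subr0.
Qed.

(** The components of a vector of ker a_0^* in the A_a^0 are again in ker a_0^*, as
[T0] z_aa is in A_a^0. *)
Lemma alphaA_ge (r : R) x : ker0adj A x ->
  (forall a, lev (-1) a -> (r%:E <= alpha (Aat a))%E) ->
  r * `|x| ^+ 2 <= `|T1 x| ^+ 2.
Proof.
move=> /ker0adjAP[Ax hx] hr; rewrite -subr_ge0.
apply: (block_quad_ge0 blockA_csub bT1 blockA_orth blockA_orth_T1).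
  exact: spA_blocks.
exact: block_q_ge0.
Qed.

(** The infimum may be infinite (no A_a^0 contains a harmonic unit vector); testing real
lower bounds [r] of it covers that case. *)
Lemma alphaA_eq : alpha A = ereal_inf [set alpha (Aat a) | a in lev (-1)].
Proof.
apply/eqP; rewrite eq_le; apply/andP; split.
  apply: le_ereal_inf_tmp => _ [a la <-]; apply: le_ereal_inf_tmp => _ [x [kx nx] <-].
  apply: ereal_inf_lbound; exists x => //; split=> //.
  have [Bx hx] := (ker0adjAatP x la).1 kx.
  apply/ker0adjAP; split=> [|a' la']; first exact: blockA_spA Bx.
  have [->//|aa] := eqVneq a' a.
  exact: (blockA_orth aa (T0_block la') Bx).
apply: le_ereal_inf_tmp => _ [x [kx nx] <-] /=.
rewrite cobd1E; last by case: kx.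
set al := ereal_inf _.
have ge r : (r%:E <= al)%E -> r <= `|T1 x| ^+ 2.
  move=> hr; have := @alphaA_ge r x kx; rewrite nx expr1n mulr1; apply.
  move=> a la; apply: (le_trans hr); apply: ereal_inf_lbound.
  by exists a.
case: al ge => [r| |] ge.
- by rewrite lee_fin ge.
- have := ge (`|T1 x| ^+ 2 + 1); rewrite leey => /(_ isT).
  by rewrite gerDl ler10.
- exact: leNye.
Qed.

(** On the kernel of b_1 the bound of (ii) is an equality. *)
Lemma ker1B_norm x : ker1 B x -> `|T1 x| ^+ 2 = kappa * `|x| ^+ 2.
Proof.
move=> [/= Bx]; rewrite cobd1E; last exact: spB_sub_spA Bx.
move=> /(orth_proj_eq0 (closed_spanP _)) h.
rewrite -!innerxx; apply: inner_T1_ker1 => // c lc.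
by apply: h; exact: zpoint_spB.
Qed.

Lemma beta_le AH BH : garland_substructure AH BH A B -> (beta AH BH <= kappa%:E)%E.
Proof.
move=> [[_ _ [_ sBA _] _ _] [_ [_ sA _] _ mA] [_ [_ sB _] _ mB]].
apply: ge_ereal_sup => _ [x [[Bx mx] /= nx] <-]; rewrite lee_fin.
have kx : ker1 B x by split; [exact: sB|rewrite -mB].
have AHx := sBA _ Bx; rewrite mA// m1E; last exact: sA.
by rewrite ker1B_norm// nx expr1n mulr1.
Qed.

(** A harmonic vector [x] of B is in ker a_0^*, and the form [q] of ratio kappa vanishes
at [x] by [ker1B_norm]. It is positive on nonzero components, so all the
components of [x] are zero. *)
Lemma H0_eq0_B : (forall a, lev (-1) a -> (kappa%:E < alpha (Aat a))%E) -> H0_eq0 B.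
Proof.
move=> hal; apply: (H0_eq0_of_harmonic complexB_is_complex) => x kx hx.
have Bx : spB P 0 z0 x by case: kx.
have Ax : spA P 0 z0 x by exact: spB_sub_spA.
have T0x a : lev (-1) a -> inner (T0 (zaa a)) x = 0.
  move=> la; have := hx (zaa a); rewrite /= spB_bot => /(_ (zaa_spA la)).
  by rewrite cobd0E ?(orth_proj_inner (closed_spanP _))//; exact: zaa_spA.
have q0 : q kappa x = 0 by rewrite /q ker1B_norm// subrr.
have hal' a (la : lev (-1) a) := ltW (hal a la).
have proj0 a : orth_proj (blockA a) x = 0.
  have [la|na] := pselect (lev (-1) a); last first.
    exact: (block_trivial na (orth_proj_in (blockA_csub a) x)).
  apply/eqP/negPn/negP => p0.
  have := block_quad_ge blockA_csub bT1 blockA_orth blockA_orth_T1 a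
    (spA_blocks Ax) (block_q_ge0 Ax T0x hal').
  rewrite -/(q kappa _) -/(q kappa x) q0 subr_le0 leNgt.
  by rewrite (alpha_block_lt la _ (hal _ la))//; exact: proj_block_ker.
apply: inner_eq0; apply: (orth_closed_span _ (spA_blocks Ax)) => y [a _ By].
by rewrite innerC; move/(orth_proj_eq0 (blockA_csub a)) : (proj0 a); apply.
Qed.

End GarlandComplexes.

Theorem proposition3p4 (R : realType) (d : Order.disp_t) (S : porderType d)
    (P : garlandPoset S) (Em E0 E1 : hilbertType R)
    (zm : S * S * S -> Em) (z0 : S * S * S -> E0) (z1 : S * S * S -> E1)
    (hzm : orthonormal_basis (triples P (-1)) zm)
    (hz0 : orthonormal_basis (triples P 0) z0)
    (hz1 : orthonormal_basis (triples P 1) z1) :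
  let A := complexA P zm z0 z1 in
  let B := complexB P zm z0 z1 in
  let kappa : R := ((n0 P)%:R - (n010 P)%:R) / (n0 P)%:R in
  [/\ cobd_formula P 0 zm z0 (map0 A) /\ cobd_formula P 1 z0 z1 (map1 A),
      garland_structure A B,
      alpha A = ereal_inf [set alpha (complexAat P zm z0 z1 a) | a in level P (-1)],
      forall AH BH : complex3 Em E0 E1, garland_substructure AH BH A B ->
        (exists x : E0, [/\ ker1 B x, sp0 BH x & x <> 0]) ->
        (beta AH BH <= kappa%:E)%E
    & (forall a, level P (-1) a -> (kappa%:E < alpha (complexAat P zm z0 z1 a))%E) ->
      H0_eq0 B].
Proof.
move=> A B kappa.
have [T0 bT0 T0E] := exists_T0 hzm hz0.
have [U bU UE] := exists_U hz0 hz1.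
have [T1 bT1 T1E] := adjoint_exists bU.
have hT : coboundaries P zm z0 z1 T0 T1.
  by split=> // a c x la lc ac; rewrite innerC -T1E UE// innerC.
split.
- by split; [exact: (cobd0_spec hz0 hT).2|exact: (cobd1_spec hz0 hz1 hT).2].
- exact: (garland_structureAB hzm hz0 hz1 hT).
- exact: (alphaA_eq hzm hz0 hz1 hT).
- by move=> AH BH hH _; exact: (beta_le hz0 hz1 hT hH).
- exact: (H0_eq0_B hzm hz0 hz1 hT).
Qed.
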